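(* Let $\mathbf{L}\in Q^2(\mathbb{D}^2)$. An analytic function $F\colon\mathbb{D}^2\to\mathbb{C}$ has bounded $\mathbf{L}$-index in joint variables if and only if for any $R'=(r_1',r_2')$, $R''=(r_1'',r_2'')$ with $0<r_j'<r_j''\le\beta$ ($j=1,2$) there exists $p_1=p_1(R',R'')\ge1$ such that for each $z^0\in\mathbb{D}^2$ $$M\Big(\frac{R''}{\mathbf{L}(z^0)},z^0,F\Big)\le p_1\,M\Big(\frac{R'}{\mathbf{L}(z^0)},z^0,F\Big).$$
   Context: $\mathbb{D}^2=\{(z_1,z_2)\in\mathbb{C}^2:|z_1|<1,|z_2|<1\}$, $\mathbb{Z}_+=\{0,1,2,\dots\}$, $\mathbb{R}_+=[0,\infty)$. A constant $\beta>1$ is fixed. $\mathbf{L}(z)=(l_1(z),l_2(z))$, where each $l_j\colon\mathbb{D}^2\to\mathbb{R}_+$ is continuous and satisfies $l_j(z_1,z_2)>\beta/(1-|z_j|)$ for all $(z_1,z_2)\in\mathbb{D}^2$, $j=1,2$. For $z^0\in\mathbb{C}^2$ and $R=(r_1,r_2)\in\mathbb{R}_+^2$: $\mathbb{D}^2[z^0,R]=\{z:|z_j-z_j^0|\le r_j,\ j=1,2\}$, $\mathbb{T}^2(z^0,R)=\{z:|z_j-z_j^0|=r_j,\ j=1,2\}$, $\frac{R}{\mathbf{L}(z^0)}=\big(\frac{r_1}{l_1(z^0)},\frac{r_2}{l_2(z^0)}\big)$, and $M(R,z^0,F)=\max\{|F(z)|: z\in\mathbb{T}^2(z^0,R)\}$.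 $F^{(p,q)}=\frac{\partial^{p+q}F}{\partial z_1^p\partial z_2^q}$. An analytic $F\colon\mathbb{D}^2\to\mathbb{C}$ has bounded $\mathbf{L}$-index in joint variables if there is $n_0\in\mathbb{Z}_+$ such that for all $z\in\mathbb{D}^2$ and all $(p_1,p_2)\in\mathbb{Z}_+^2$: $\frac{|F^{(p_1,p_2)}(z)|}{p_1!p_2!\,l_1^{p_1}(z)l_2^{p_2}(z)}\le\max\{\frac{|F^{(k_1,k_2)}(z)|}{k_1!k_2!\,l_1^{k_1}(z)l_2^{k_2}(z)}:0\le k_1+k_2\le n_0\}$. $Q^2(\mathbb{D}^2)$ is the class of such $\mathbf{L}$ for which, for all $R=(r_1,r_2)\in[0,\beta]^2$ and $j=1,2$, $0<\lambda_{1,j}(R)\le\lambda_{2,j}(R)<\infty$, where $\lambda_{1,j}(R)=\inf_{z^0\in\mathbb{D}^2}\inf\{l_j(z)/l_j(z^0): z\in\mathbb{D}^2[z^0,R/\mathbf{L}(z^0)]\}$ and $\lambda_{2,j}(R)=\sup_{z^0\in\mathbb{D}^2}\sup\{l_j(z)/l_j(z^0): z\in\mathbb{D}^2[z^0,R/\mathbf{L}(z^0)]\}$. *)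

(* Defs.v *)
(* Complex numbers: real_closed's
   [R[i]] for [R : realType]; we use the regular copy [R[i]^o], which is a
   normedModType over R[i] itself, so that [differentiable] and ['D_v]
   are complex (C-linear) derivatives. *)
From HB Require Import structures.
From mathcomp Require Import all_boot all_order all_algebra.
From mathcomp Require Import complex.
From mathcomp Require Import all_classical all_reals all_analysis.
Import Order.TTheory GRing.Theory Num.Theory.
Import numFieldNormedType.Exports.

Set Implicit Arguments.
Unset Strict Implicit.
Unset Printing Implicit Defensive.

Local Open Scope ring_scope.
Local Open Scope classical_set_scope.

Notation CC R := ((R[i])^o).

Section Defs.
Variable R : realType.

Definition cabs (z : CC R) : R := Normc.normc (z : R[i]).

Definition D2 (z : CC R * CC R) : Prop := cabs z.1 < 1 /\ cabs z.2 < 1.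

Definition polydisc (z0 : CC R * CC R) (r1 r2 : R) : set (CC R * CC R) :=
  [set z | cabs (z.1 - z0.1) <= r1 /\ cabs (z.2 - z0.2) <= r2].

Definition torus (z0 : CC R * CC R) (r1 r2 : R) : set (CC R * CC R) :=
  [set z | cabs (z.1 - z0.1) = r1 /\ cabs (z.2 - z0.2) = r2].

(* M((r1,r2), z0, F) = max of |F| over the torus (a max for continuous F) *)
Definition Mmax (F : CC R * CC R -> CC R) (z0 : CC R * CC R) (r1 r2 : R) : R :=
  sup [set cabs (F z) | z in torus z0 r1 r2].

Definition dz1 (G : CC R * CC R -> CC R) : CC R * CC R -> CC R :=
  fun z => 'D_((1 : CC R), (0 : CC R)) G z.
Definition dz2 (G : CC R * CC R -> CC R) : CC R * CC R -> CC R :=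
  fun z => 'D_((0 : CC R), (1 : CC R)) G z.
Definition pderiv (F : CC R * CC R -> CC R) (p q : nat) : CC R * CC R -> CC R :=
  iter p dz1 (iter q dz2 F).

(* analytic (holomorphic) on D^2: complex (C-linear Frechet) differentiable
   at every point of the open set D^2 *)
Definition analytic_D2 (F : CC R * CC R -> CC R) : Prop :=
  forall z, D2 z -> differentiable F z.

Definition admissible_L (beta : R) (l1 l2 : CC R * CC R -> R) : Prop :=
  forall z, D2 z ->
    [/\ {for z, continuous l1}, {for z, continuous l2},
        beta / (1 - cabs z.1) < l1 z & beta / (1 - cabs z.2) < l2 z].

(* lambda_{1,j}(R) > 0 and lambda_{2,j}(R) < +oo for the function l = l_j
   (lambda_{1,j} <= lambda_{2,j} always holds, take z = z0) *)
Definition lambda_cond (l1 l2 l : CC R * CC R -> R) (r1 r2 : R) : Prop :=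
  (exists2 c : R, 0 < c & forall z0, D2 z0 -> forall z,
      polydisc z0 (r1 / l1 z0) (r2 / l2 z0) z -> c <= l z / l z0) /\
  (exists C : R, forall z0, D2 z0 -> forall z,
      polydisc z0 (r1 / l1 z0) (r2 / l2 z0) z -> l z / l z0 <= C).

Definition inQ2 (beta : R) (l1 l2 : CC R * CC R -> R) : Prop :=
  forall r1 r2 : R, 0 <= r1 <= beta -> 0 <= r2 <= beta ->
    lambda_cond l1 l2 l1 r1 r2 /\ lambda_cond l1 l2 l2 r1 r2.

Definition index_term (l1 l2 : CC R * CC R -> R) (F : CC R * CC R -> CC R)
    (z : CC R * CC R) (p1 p2 : nat) : R :=
  cabs (pderiv F p1 p2 z) /
    ((p1`!)%:R * (p2`!)%:R * l1 z ^+ p1 * l2 z ^+ p2).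

Definition bounded_L_index (l1 l2 : CC R * CC R -> R) (F : CC R * CC R -> CC R) : Prop :=
  exists n0 : nat, forall z, D2 z -> forall p1 p2 : nat,
    index_term l1 l2 F z p1 p2 <=
      \big[Num.max/0]_(k1 < n0.+1) \big[Num.max/0]_(k2 < n0.+1 | (k1 + k2 <= n0)%N)
         index_term l1 l2 F z k1 k2.

End Defs.

(* Main.v *)
(* Bounded index gives growth control: with A(z) the largest normalised
   derivative of order at most N at z, the Taylor series at z bounds |F| by
   4 A(z) on the polydisc of radii 1/(2 l_j(z)), and Cauchy's estimates then
   bound A(w) by a constant times A(z) for w in the polydisc of radii
   1/(4 l_j(z)).  A chain of boundedly many such steps reaches all of the
   polydisc of radii beta/l_j(z), and A(z) is at most a constant times the
   maximum over the small torus, again by Cauchy.  Conversely, growth control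
   from radii 1/l_j to beta/l_j bounds the maximum T over the large torus by the
   Taylor coefficients of order < n plus a small multiple of T, which is
   absorbed; Cauchy's estimates on the large torus make the normalised
   derivatives decay like beta^-(p+q), so those of high order are dominated.

   The Taylor expansion and Cauchy's estimates are derived from
   Frechet differentiability only.  For g(s + it) = f(e^s cis t), Goursat's
   quadrisection shows that the circle mean of f does not depend on the radius
   on an annulus where f is differentiable; by continuity this persists across an
   exceptional circle.  Applied to u (f u - f z) / (u - z), which vanishes at 0,
   it yields Cauchy's formula at z.  Bounds on complex integrals lose a
   factor 2 since real and imaginary parts are estimated separately; the argument
   tolerates any such constant. *)
Require Import Defs.
From HB Require Import structures.
From mathcomp Require Import all_boot all_order all_algebra.
From mathcomp Require Import complex.
From mathcomp Require Import all_classical all_reals all_analysis.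
From mathcomp Require Import ring lra.
Set Implicit Arguments.
Unset Strict Implicit.
Unset Printing Implicit Defensive.
Import Order.TTheory GRing.Theory Num.Theory.
Import numFieldNormedType.Exports.
Local Open Scope ring_scope.
Local Open Scope classical_set_scope.
Local Open Scope complex_scope.

(** * The modulus and the topology of the complex plane *)

Section Cabs.
Variable R : realType.
Implicit Types (z w : CC R) (x y : R).

Lemma cabs_norm z : `|z| = (cabs z)%:C.
Proof. by case: z => a b; exact: normc_def. Qed.

Lemma cabs_ge0 z : 0 <= cabs z.
Proof. by case: z => a b; exact: sqrtr_ge0. Qed.

Lemma cabsE z : cabs z = complex.Re (`|z| : R[i]).
Proof. by rewrite cabs_norm. Qed.

Lemma cabs0 : cabs (0 : CC R) = 0.
Proof. by rewrite cabsE normr0. Qed.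

Lemma cabs1 : cabs (1 : CC R) = 1.
Proof. by rewrite cabsE normr1. Qed.

Lemma cabs_eq0 z : (cabs z == 0) = (z == 0).
Proof.
apply/eqP/eqP => [|->]; last exact: cabs0.
exact: ComplexField.Normc.eq0_normc.
Qed.

Lemma cabs_gt0 z : (0 < cabs z) = (z != 0).
Proof. by rewrite lt_def cabs_ge0 andbT cabs_eq0. Qed.

Lemma cabsM z w : cabs (z * w) = cabs z * cabs w.
Proof. exact: ComplexField.Normc.normcM. Qed.

Lemma cabsV z : cabs z^-1 = (cabs z)^-1.
Proof. exact: ComplexField.Normc.normcV. Qed.

Lemma cabsN z : cabs (- z) = cabs z.
Proof. exact: normcN. Qed.

Lemma cabsD z w : cabs (z + w) <= cabs z + cabs w.
Proof. exact: le_normcD. Qed.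

Lemma cabsB z w : cabs (z - w) <= cabs z + cabs w.
Proof. by rewrite -(cabsN w) cabsD. Qed.

Lemma cabs_dist z w : cabs (z - w) = cabs (w - z).
Proof. by rewrite -cabsN opprB. Qed.

Lemma cabs_leB z w : cabs z - cabs w <= cabs (z - w).
Proof. by rewrite lerBlDr -{1}(subrK w z) cabsD. Qed.

Lemma cabsX z n : cabs (z ^+ n) = cabs z ^+ n.
Proof.
by elim: n => [|n IH]; rewrite ?expr0 ?cabs1// !exprS cabsM IH.
Qed.

Lemma cabs_real x : cabs (x%:C : CC R) = `|x|.
Proof. by rewrite /cabs /= expr0n /= addr0 sqrtr_sqr. Qed.

Lemma cabs_nat n : cabs (n%:R : CC R) = n%:R.
Proof.
have -> : (n%:R : CC R) = (n%:R : R)%:C by rewrite -(rmorph_nat (real_complex R)).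
by rewrite cabs_real normr_nat.
Qed.

Lemma cabs_sum (I : Type) (r : seq I) (P : pred I) (F : I -> CC R) :
  cabs (\sum_(i <- r | P i) F i) <= \sum_(i <- r | P i) cabs (F i).
Proof.
elim/big_ind2 : _ => [|z1 x1 z2 x2 h1 h2|//]; first by rewrite cabs0.
exact: (le_trans (cabsD _ _) (lerD h1 h2)).
Qed.

Lemma Re_le_cabs z : `|complex.Re z| <= cabs z.
Proof.
case: z => a b; rewrite /cabs /= -sqrtr_sqr; apply: ler_wsqrtr.
by rewrite lerDl sqr_ge0.
Qed.

Lemma Im_le_cabs z : `|complex.Im z| <= cabs z.
Proof.
case: z => a b; rewrite /cabs /= -sqrtr_sqr; apply: ler_wsqrtr.
by rewrite lerDr sqr_ge0.
Qed.

Lemma cabs_iE x y : cabs (x +i* y : CC R) = Num.sqrt (x ^+ 2 + y ^+ 2).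
Proof. by []. Qed.

Lemma cabs_le_ReIm x y : cabs (x +i* y : CC R) <= `|x| + `|y|.
Proof.
rewrite cabs_iE -[leRHS]ger0_norm ?addr_ge0// -sqrtr_sqr; apply: ler_wsqrtr.
rewrite -(real_normK (num_real x)) -(real_normK (num_real y)).
have := normr_ge0 x; have := normr_ge0 y; nra.
Qed.

(** The norm of [CC R] takes values in [R[i]], so its balls have complex radii; a positive element
    of [R[i]] has zero imaginary part, which lets real radii replace them. *)
Lemma nbhs_cabsP z (P : set (CC R)) :
  nbhs z P <-> exists2 d : R, 0 < d & forall w, cabs (w - z) < d -> P w.
Proof.
split.
- move/nbhs_normP => [e /= e0 eP].
  have eR : e = (complex.Re e)%:C.
    by apply/eqP; rewrite eq_complex /= eqxx /=; move: e0; rewrite ltcE /= => /andP[].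
  exists (complex.Re e); first by move: e0; rewrite ltcE /= => /andP[].
  move=> w wz; apply: eP => /=; rewrite cabs_norm cabs_dist eR.
  by rewrite ltcR.
- move=> [d d0 dP]; apply: (proj2 (nbhs_normP z P)); exists (d%:C); first by rewrite /= ltcR.
  move=> w /=; rewrite cabs_norm ltcR => wz; apply: dP.
  by rewrite cabs_dist.
Qed.

Lemma cvg_cabsP (T : Type) (F : set_system T) (FF : Filter F) (f : T -> CC R) l :
  f @ F --> l <-> forall e : R, 0 < e -> \forall t \near F, cabs (f t - l) < e.
Proof.
split=> [fl e e0|H].
- apply: (fl [set w | cabs (w - l) < e]).
  by apply/nbhs_cabsP; exists e.
- move=> P /nbhs_cabsP[d d0 dP]; have := H _ d0.
  by apply: filterS => t; exact: dP.
Qed.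

Lemma continuous_cabs : continuous (@cabs R).
Proof.
move=> z; apply: (proj2 (@cvgrPdist_lt _ _ _ _ (nbhs_filter z) _ _)) => e e0; apply/nbhs_cabsP; exists e => // w wz.
rewrite ltr_norml; have := cabs_leB z w; have := cabs_leB w z.
by rewrite (cabs_dist z w); lra.
Qed.

Lemma continuous_Re : continuous (fun z : CC R => complex.Re z).
Proof.
move=> z; apply: (proj2 (@cvgrPdist_lt _ _ _ _ (nbhs_filter z) _ _)) => e e0; apply/nbhs_cabsP; exists e => // w wz.
rewrite (le_lt_trans _ wz)// cabs_dist; move: (Re_le_cabs (z - w)).
by case: z w {wz} => [a b] [c d].
Qed.

Lemma continuous_Im : continuous (fun z : CC R => complex.Im z).
Proof.
move=> z; apply: (proj2 (@cvgrPdist_lt _ _ _ _ (nbhs_filter z) _ _)) => e e0; apply/nbhs_cabsP; exists e => // w wz.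
rewrite (le_lt_trans _ wz)// cabs_dist; move: (Im_le_cabs (z - w)).
by case: z w {wz} => [a b] [c d].
Qed.

Lemma cvg_complex (T : Type) (F : set_system T) (FF : Filter F) (f g : T -> R) a b :
  f @ F --> a -> g @ F --> b -> (fun t => (f t +i* g t) : CC R) @ F --> (a +i* b : CC R).
Proof.
move=> fa gb; apply/cvg_cabsP => e e0.
have e20 : 0 < e / 2 by rewrite divr_gt0.
move/cvgrPdist_lt : fa => /(_ _ e20) fa; move/cvgrPdist_lt : gb => /(_ _ e20) gb.
near=> t.
have ha : `|a - f t| < e / 2 by near: t.
have hb : `|b - g t| < e / 2 by near: t.
rewrite (le_lt_trans (cabs_le_ReIm (f t - a) (g t - b)))//.
by rewrite (distrC (f t)) (distrC (g t)); lra.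
Unshelve. all: by end_near. Qed.

End Cabs.

(** * Integrals of complex-valued functions of a real variable *)

Section Cint.
Variable R : realType.
Implicit Types (a b c : R) (h k : R -> CC R) (f g : R -> R).
Let mu := @lebesgue_measure R.

Lemma continuous_itv_integrable a b f : continuous f ->
  mu.-integrable `[a, b] (EFin \o f).
Proof.
move=> cf; apply: continuous_compact_integrable; first exact: segment_compact.
exact: continuous_subspaceT.
Qed.

Lemma Rintegral_itv_split a b c f : continuous f -> a <= b -> b <= c ->
  \int[mu]_(t in `[a, c]) f t = \int[mu]_(t in `[a, b]) f t + \int[mu]_(t in `[b, c]) f t.
Proof.
move=> cf ab bc.
have := @Rintegral_itvB R f (BLeft a) (BRight c) b (continuous_itv_integrable a c cf).
rewrite !bnd_simp => /(_ ab bc) /eqP; rewrite subr_eq => /eqP ->.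
rewrite addrC; congr (_ + _); rewrite Rintegral_itv_obnd_cbnd//.
apply: integrableS (continuous_itv_integrable b c cf) => //.
by apply: subset_itvr; rewrite bnd_simp.
Qed.

Lemma Rintegral_itv_derive a b (F f : R -> R) : a <= b -> continuous f ->
  (forall x : R, is_derive x (1 : R) F (f x)) ->
  \int[mu]_(t in `[a, b]) f t = F b - F a.
Proof.
rewrite le_eqVlt => /predU1P[-> _ _|ab cf dF].
  by rewrite set_itv1 Rintegral_set1 subrr.
have cF : continuous F.
  move=> x; apply: differentiable_continuous; apply/derivable1_diffP.
  by have [] := dF x.
rewrite /Rintegral (@continuous_FTC2 _ f F)//.
- exact: continuous_subspaceT.
- split.
  + by move=> x _; have [] := dF x.
  + by apply: cvg_at_right_filter; exact: cF.
  + by apply: cvg_at_left_filter; exact: cF.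
- by move=> x _; rewrite derive1E; have [_ ->] := dF x.
Qed.

Lemma Rintegral_itv_cst a b (x : R) : a <= b ->
  \int[mu]_(t in `[a, b]) x = x * (b - a).
Proof.
move=> ab; have D (t : R) : is_derive t (1 : R) (fun t => x * t) x.
  by apply: is_derive_eq; rewrite /GRing.scale /= mulr1.
rewrite (Rintegral_itv_derive ab (f := fun=> x) _ D) ?mulrBr// => t; exact: cvg_cst.
Qed.

Lemma le_Rintegral_itv a b f (M : R) : continuous f -> a <= b ->
  (forall t, a <= t <= b -> `|f t| <= M) ->
  `|\int[mu]_(t in `[a, b]) f t| <= M * (b - a).
Proof.
move=> cf ab fM.
apply: le_trans.
  by apply: le_normr_Rintegral => //; exact: continuous_itv_integrable.
have -> : M * (b - a) = \int[mu]_(t in `[a, b]) M.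
  by rewrite Rintegral_itv_cst.
apply: le_Rintegral => //.
- by apply: continuous_itv_integrable => x; apply: cvg_norm; exact: cf.
- by apply: continuous_itv_integrable => x; exact: cvg_cst.
Qed.

(** Integrating the two components separately reduces everything to real Lebesgue integrals; the
    price is the factor 2 in [cint_le]. *)
Definition cint a b h : CC R :=
  (\int[mu]_(t in `[a, b]) complex.Re (h t)) +i* (\int[mu]_(t in `[a, b]) complex.Im (h t)).

Lemma cReD (z w : CC R) : complex.Re (z + w) = complex.Re z + complex.Re w.
Proof. by case: z w => [? ?] [? ?]. Qed.

Lemma cImD (z w : CC R) : complex.Im (z + w) = complex.Im z + complex.Im w.
Proof. by case: z w => [? ?] [? ?]. Qed.

Lemma continuous_ReT (T : topologicalType) (h : T -> CC R) : continuous h -> continuous (fun t => complex.Re (h t)).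
Proof. move=> ch x; apply: (@continuous_comp _ _ _ h (fun z => complex.Re z)); [exact: ch|exact: continuous_Re]. Qed.

Lemma continuous_ImT (T : topologicalType) (h : T -> CC R) : continuous h -> continuous (fun t => complex.Im (h t)).
Proof. move=> ch x; apply: (@continuous_comp _ _ _ h (fun z => complex.Im z)); [exact: ch|exact: continuous_Im]. Qed.

Lemma eq_cint a b h k : (forall t, a <= t <= b -> h t = k t) -> cint a b h = cint a b k.
Proof.
by move=> hk; rewrite /cint; congr (_ +i* _); apply: eq_Rintegral => t;
  rewrite inE /= in_itv /= => /hk ->.
Qed.

Lemma cintD a b h k : continuous h -> continuous k ->
  cint a b (fun t => h t + k t) = cint a b h + cint a b k.
Proof.
move=> ch ck; rewrite /cint.
under eq_Rintegral do rewrite cReD.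
under [X in _ +i* X]eq_Rintegral do rewrite cImD.
have ih f : continuous f -> mu.-integrable `[a, b] (EFin \o f) by exact: continuous_itv_integrable.
congr (_ +i* _); apply: RintegralD.
- exact: measurable_itv.
- by apply: ih; exact: continuous_ReT ch.
- by apply: ih; exact: continuous_ReT ck.
- exact: measurable_itv.
- by apply: ih; exact: continuous_ImT ch.
- by apply: ih; exact: continuous_ImT ck.
Qed.

Lemma cintZ a b (z : CC R) h : continuous h ->
  cint a b (fun t => z * h t) = z * cint a b h.
Proof.
move=> ch; rewrite /cint; case: z => x y.
have cR := continuous_ReT ch; have cI := continuous_ImT ch.
have E1 t : complex.Re ((x +i* y : CC R) * h t) = x * complex.Re (h t) - y * complex.Im (h t).
  by case: (h t).
have E2 t : complex.Im ((x +i* y : CC R) * h t) = x * complex.Im (h t) + y * complex.Re (h t).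
  by case: (h t).
under eq_Rintegral do rewrite E1.
under [X in _ +i* X]eq_Rintegral do rewrite E2.
have cm (r : R) (f : R -> R) : continuous f -> continuous (fun t => r * f t).
  by move=> cf t; apply: cvgM; [exact: cvg_cst|exact: cf].
rewrite RintegralB ?RintegralD// ?RintegralZl//; try exact: continuous_itv_integrable.
all: by apply: continuous_itv_integrable; exact: cm.
Qed.

Lemma cintN a b h : continuous h -> cint a b (fun t => - h t) = - cint a b h.
Proof.
by move=> ch; rewrite -mulN1r -cintZ//; apply: eq_cint => t _; rewrite mulN1r.
Qed.

Lemma cintB a b h k : continuous h -> continuous k ->
  cint a b (fun t => h t - k t) = cint a b h - cint a b k.
Proof.
move=> ch ck; have cNk : continuous (fun t => - k t) by move=> t; exact: (cvgN (ck t)).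
by rewrite (cintD a b ch cNk) (cintN a b ck).
Qed.

Lemma cint0 a b : cint a b (fun=> 0) = 0.
Proof.
rewrite -[RHS](mul0r (cint a b (fun=> 0))) -cintZ; last by move=> t; exact: cvg_cst.
by apply: eq_cint => t _; rewrite mul0r.
Qed.

Lemma continuous_csum n (h : nat -> R -> CC R) : (forall i, continuous (h i)) ->
  continuous (fun t => \sum_(i < n) h i t).
Proof.
move=> ch; elim: n => [|n IH].
  under eq_fun do rewrite big_ord0.
  by move=> t; exact: cvg_cst.
under eq_fun do rewrite big_ord_recr /=.
by move=> t; apply: cvgD; [exact: IH|exact: ch].
Qed.

Lemma cint_sum a b n (h : nat -> R -> CC R) : (forall i, continuous (h i)) ->
  cint a b (fun t => \sum_(i < n) h i t) = \sum_(i < n) cint a b (h i).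
Proof.
move=> ch; elim: n => [|n IH].
  rewrite big_ord0 -[RHS](cint0 a b); apply: eq_cint => t _; by rewrite big_ord0.
rewrite big_ord_recr /= -IH -cintD//; last exact: continuous_csum.
by apply: eq_cint => t _; rewrite big_ord_recr.
Qed.

Lemma cint_cst a b (z : CC R) : a <= b -> cint a b (fun=> z) = z * ((b - a)%:C : CC R).
Proof.
move=> ab; rewrite /cint !Rintegral_itv_cst//; case: z => x y.
by apply/eqP; rewrite eq_complex /= !mulr0 subr0 add0r !eqxx.
Qed.

Lemma cint_id a b : a <= b -> cint a b (fun t => (t%:C : CC R)) = ((b ^+ 2 - a ^+ 2) / 2)%:C.
Proof.
move=> ab; have D (t : R) : is_derive t (1 : R) (fun t => 2^-1 * (t * t)) t.
  by apply: is_derive_eq; rewrite /GRing.scale /= !mulr1; lra.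
rewrite /cint; congr (_ +i* _).
  have -> := Rintegral_itv_derive ab (f := id) _ D; first by lra.
  by move=> t; exact: cvg_id.
by rewrite -[LHS]/(\int[mu]_(t in `[a, b]) (0 : R)) Rintegral_itv_cst// mul0r.
Qed.

Lemma cint_split a b c h : continuous h -> a <= b -> b <= c ->
  cint a c h = cint a b h + cint b c h.
Proof.
move=> ch ab bc; rewrite /cint (@Rintegral_itv_split a b c)//; last exact: continuous_ReT.
by rewrite (@Rintegral_itv_split a b c)//; exact: continuous_ImT.
Qed.

Lemma cint_le a b h M : continuous h -> a <= b ->
  (forall t, a <= t <= b -> cabs (h t) <= M) ->
  cabs (cint a b h) <= 2 * M * (b - a).
Proof.
move=> ch ab hM; rewrite (le_trans (cabs_le_ReIm _ _))//.
rewrite -mulrA mulr_natl mulr2n; apply: lerD; apply: le_Rintegral_itv => //.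
- exact: continuous_ReT.
- by move=> t /hM; apply: le_trans; exact: Re_le_cabs.
- exact: continuous_ImT.
- by move=> t /hM; apply: le_trans; exact: Im_le_cabs.
Qed.

Lemma continuous_pairT (T U V : topologicalType) (f : T -> U) (g : T -> V) :
  continuous f -> continuous g -> continuous (fun t => (f t, g t)).
Proof.
by move=> cf cg t; apply: cvg_pair => //; [exact: cf|exact: cg].
Qed.

(** Compactness of [[a, b]] turns joint continuity into closeness of [h x] to [h x0] uniformly in
    [t], for [x] near [x0]. *)
Lemma continuous_cint (T : topologicalType) a b (h : T -> R -> CC R) : a <= b ->
  continuous (fun p : T * R => h p.1 p.2) ->
  continuous (fun x => cint a b (h x)).
Proof.
move=> ab ch x0.
have ch2 x : continuous (h x).
  move=> t; apply: (@continuous_comp _ _ _ (fun t => (x, t)) (fun p => h p.1 p.2)).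
    by move: t; apply: continuous_pairT => t; [exact: cvg_cst|exact: cvg_id].
  exact: ch.
apply/cvg_cabsP => e e0.
(* Chosen so that [2 * d * (b - a) < e]; the added 1 keeps the denominator positive when [a = b]. *)
set d := e / (2 * (b - a) + 1).
have d0 : 0 < d by rewrite divr_gt0//; lra.
have /compact_near_coveringP K : compact (`[a, b]%classic : set R) by exact: segment_compact.
have : \forall x \near x0, `[a, b] `<=` (fun t => cabs (h x t - h x0 t) < d).
  apply: (K _ (nbhs x0) (fun x t => cabs (h x t - h x0 t) < d) _) => t _ /=.
  have d20 : 0 < d / 2 by rewrite divr_gt0.
  have /cvg_cabsP/(_ _ d20) H := ch (x0, t).
  have /cvg_cabsP/(_ _ d20) H2 := ch2 x0 t.
  have [[A B] /= [xA tB] AB] : nbhs (x0, t) [set p : T * R | cabs (h p.1 p.2 - h x0 t) < d / 2] by exact: H.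
  exists ((B `&` [set s | cabs (h x0 s - h x0 t) < d / 2]), A).
    by split => //=; apply: filterI.
  move=> [s y] /= [[Bs hs] Ay].
  have := AB (y, s) (conj Ay Bs) => /=.
  have -> : h y s - h x0 s = (h y s - h x0 t) - (h x0 s - h x0 t) by ring.
  by have := cabsB (h y s - h x0 t) (h x0 s - h x0 t); lra.
apply: filterS => x hx.
rewrite -cintB//; apply: le_lt_trans.
  apply: (@cint_le _ _ _ d) => //.
    by move=> t; apply: cvgB; exact: ch2.
  by move=> t tab; apply/ltW/hx; rewrite /= in_itv.
rewrite /d -mulrA mulrCA; rewrite mulrAC ltr_pdivrMr; last lra.
by rewrite ltr_pM2l//; lra.
Qed.

End Cint.

(** * Complex differentiability in epsilon form *)

Section Cdiff.
Variable R : realType.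
Implicit Types (f : CC R -> CC R) (z w d : CC R).

(** The inequality is non-strict so that [w = z] is included, and all epsilons are real. *)
Definition cdiff f z d := forall e : R, 0 < e -> exists2 r : R, 0 < r &
  forall w, cabs (w - z) < r -> cabs (f w - f z - d * (w - z)) <= e * cabs (w - z).

Lemma is_derive_cdiff f z d : is_derive z (1 : CC R) f d -> cdiff f z d.
Proof.
move=> [df fd] e e0; move: df; rewrite /derivable => /cvg_ex[l hl].
have ld : l = d by rewrite -fd /derive; apply/esym/cvg_lim => //; exact: norm_hausdorff.
move/cvg_cabsP : hl => /(_ _ e0).
rewrite /dnbhs /within /= => /nbhs_cabsP[r r0 H].
exists r => // w wz; have [->|wz0] := eqVneq w z.
  by rewrite !subrr mulr0 subrr cabs0 mulr0.
have wz1 : w - z != 0 by rewrite subr_eq0.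
have := H (w - z); rewrite subr0 => /(_ wz wz1); rewrite ld.
rewrite /GRing.scale /= mulr1 subrK => h.
have -> : f w - f z - d * (w - z) = ((w - z)^-1 * (f w - f z) - d) * (w - z).
  by rewrite mulrBl mulrAC mulVf// mul1r.
by rewrite cabsM ler_wpM2r ?cabs_ge0// ltW.
Qed.

Lemma cdiff_is_derive f z d : cdiff f z d -> is_derive z (1 : CC R) f d.
Proof.
move=> H.
have C : (fun h : CC R => h^-1 *: (f (h *: (1 : CC R) + z) - f z)) @ 0^' --> d.
  apply/cvg_cabsP => e e0; have e20 : 0 < e / 2 by rewrite divr_gt0.
  have [r r0 {}H] := H _ e20.
  rewrite /dnbhs /within /=; apply/nbhs_cabsP; exists r => // h; rewrite subr0 => hr h0.
  have h00 : 0 < cabs h by rewrite cabs_gt0.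
  have := H (h + z); rewrite addrK => /(_ hr) {}H.
  rewrite /GRing.scale /= mulr1.
  have -> : h^-1 * (f (h + z) - f z) - d = h^-1 * (f (h + z) - f z - d * h).
    by rewrite [RHS]mulrBr [d * h]mulrC mulrA mulVf// mul1r.
  rewrite cabsM cabsV mulrC ltr_pdivrMr//.
  by apply: (le_lt_trans H); rewrite ltr_pM2r//; lra.
by split; [apply/cvg_ex; exists d|apply/cvg_lim => //; exact: norm_hausdorff].
Qed.

End Cdiff.

(** * Logarithmic polar coordinates *)

Section Polar.
Variable R : realType.
Implicit Types (f : CC R -> CC R) (g : R -> R -> CC R).

Definition cis (t : R) : CC R := cos t +i* sin t.

Lemma cisD s t : cis (s + t) = cis s * cis t.
Proof.
by apply/eqP; rewrite eq_complex /= cosD sinD; apply/andP; split; apply/eqP; ring.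
Qed.

Lemma cis0 : cis 0 = 1.
Proof. by rewrite /cis cos0 sin0. Qed.

Lemma cis2pi : cis (pi *+ 2) = 1.
Proof. by rewrite /cis cos2pi sin2pi. Qed.

Lemma cabs_cis t : cabs (cis t) = 1.
Proof. by rewrite cabs_iE cos2Dsin2 sqrtr1. Qed.

Lemma cis_neq0 t : cis t != 0.
Proof. by rewrite -cabs_gt0 cabs_cis. Qed.

Lemma cisV t : (cis t)^-1 = cis (- t).
Proof. by apply: (mulfI (cis_neq0 t)); rewrite mulfV ?cis_neq0// -cisD subrr cis0. Qed.

Lemma cisX t n : cis t ^+ n = cis (n%:R * t).
Proof.
elim: n => [|n IH]; first by rewrite mul0r cis0 expr0.
by rewrite exprS IH -cisD -[n.+1%:R]natr1 mulrDl mul1r addrC.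
Qed.

Lemma continuous_cis : continuous cis.
Proof.
by move=> t; apply: cvg_complex; [exact: continuous_cos|exact: continuous_sin].
Qed.

Lemma is_derive_eps (F : R -> R) (x l : R) : is_derive x (1 : R) F l ->
  forall e : R, 0 < e -> exists2 d : R, 0 < d & forall h : R, `|h| < d ->
    `|F (h + x) - F x - l * h| <= e * `|h|.
Proof.
move=> [dF Fl] e e0; move: dF; rewrite /derivable => /cvg_ex[l' hl].
have ld : l' = l by rewrite -Fl /derive; apply/esym/cvg_lim => //; exact: norm_hausdorff.
move/cvgrPdist_lt : hl => /(_ _ e0).
rewrite /dnbhs /within /= => /nbhs_ballP[r /= r0 H].
exists r => // h hr; have [->|h0] := eqVneq h 0.
  by rewrite add0r subrr mulr0 subrr normr0 mulr0.
have := H h; rewrite /ball /= sub0r normrN => /(_ hr h0); rewrite ld.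
rewrite /GRing.scale /= mulr1 => hh.
have -> : F (h + x) - F x - l * h = (h^-1 * (F (h + x) - F x) - l) * h.
  by rewrite mulrBl mulrAC mulVf// mul1r.
by rewrite normrM ler_wpM2r// distrC ltW.
Qed.

Lemma cis_expansion (e : R) : 0 < e -> exists2 d : R, 0 < d & forall t : R, `|t| < d ->
  cabs (cis t - 1 - (0 +i* t)) <= e * `|t|.
Proof.
move=> e0; have e20 : 0 < e / 2 by rewrite divr_gt0.
have [d1 d10 H1] := is_derive_eps (is_derive_cos (0 : R)) e20.
have [d2 d20 H2] := is_derive_eps (is_derive_sin (0 : R)) e20.
exists (Num.min d1 d2); first by rewrite lt_min d10.
move=> t; rewrite lt_min => /andP[/H1 h1 /H2 h2].
move: h1 h2; rewrite !addr0 cos0 sin0 => h1 h2.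
have -> : cis t - 1 - (0 +i* t) = (cos t - 1) +i* (sin t - t) :> CC R.
  by apply/eqP; rewrite eq_complex /=; apply/andP; split; apply/eqP; ring.
rewrite (le_trans (cabs_le_ReIm _ _))//.
rewrite oppr0 mul0r subr0 in h1; rewrite mul1r subr0 in h2; lra.
Qed.

(* Complex differentiability of s + it |-> g s t at s0 + i t0. *)
Definition plane_diff g s0 t0 := exists A : CC R, forall e : R, 0 < e ->
  exists2 d : R, 0 < d & forall s t, `|s - s0| + `|t - t0| < d ->
  cabs (g s t - g s0 t0 - A * ((s - s0) +i* (t - t0))) <= e * (`|s - s0| + `|t - t0|).

(** The complex exponential of [s + it]. It unrolls an annulus into a rectangle whose sides [t = 0]
    and [t = 2 pi] have the same image. *)
Definition polar (s t : R) : CC R := (expR s)%:C * cis t.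

Lemma cabs_polar s t : cabs (polar s t) = expR s.
Proof. by rewrite /polar cabsM cabs_cis mulr1 cabs_real ger0_norm ?expR_ge0. Qed.

Lemma polarD s t s' t' : polar (s + s') (t + t') = polar s t * polar s' t'.
Proof. by rewrite /polar expRD cisD rmorphM /=; ring. Qed.

Lemma polar_expansion (e : R) : 0 < e -> exists2 d : R, 0 < d & forall s t,
  `|s| + `|t| < d -> cabs (polar s t - 1 - (s +i* t)) <= e * (`|s| + `|t|).
Proof.
move=> e0; have e30 : 0 < e / 3 by rewrite divr_gt0.
have [d1 d10 H1] := is_derive_eps (is_derive_expR (0 : R)) e30.
have [d2 d20 H2] := cis_expansion e30.
exists (Num.min 1 (Num.min (e / 3) (Num.min d1 d2))).
  by rewrite !lt_min ltr01 e30 d10.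
move=> s t; rewrite !lt_min => /and4P[st1 st2 st3 st4].
have s0 := normr_ge0 s; have t0 := normr_ge0 t.
have {}/H1 : `|s| < d1 by lra.
rewrite addr0 expR0 mul1r => H1.
have {}/H2 H2 : `|t| < d2 by lra.
(* The three summands are the error of [expR], the error of [cis] scaled by [1 + s] (of modulus at
   most 2), and the cross term [s * it], which is of second order and small because
   [|t| < e / 3]. *)
have -> : polar s t - 1 - (s +i* t) =
    (expR s - 1 - s)%:C * cis t + (1 + s)%:C * (cis t - 1 - (0 +i* t)) + (s%:C * (0 +i* t)) :> CC R.
  by apply/eqP; rewrite eq_complex /=; apply/andP; split; apply/eqP; ring.
apply: (le_trans (cabsD _ _)).
apply: (le_trans (lerD (cabsD _ _) (lexx _))).
rewrite !cabsM cabs_cis mulr1 !cabs_real.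
have -> : cabs (0 +i* t : CC R) = `|t| by rewrite cabs_iE expr0n /= add0r sqrtr_sqr.
have h1s : `|1 + s| <= 2 by rewrite (le_trans (ler_normD _ _))// normr1; lra.
have : `|1 + s| * cabs (cis t - 1 - 0 +i* t) <= 2 * (e / 3 * `|t|).
  by rewrite ler_pM// ?cabs_ge0.
by move: H1; nra.
Qed.

(** Chain rule: by [polarD] the expansion of [polar] at 0 gives derivative [polar s0 t0] everywhere,
    so the composite has derivative [d * polar s0 t0]. *)
Lemma polar_plane_diff f s0 t0 d : cdiff f (polar s0 t0) d ->
  plane_diff (fun s t => f (polar s t)) s0 t0.
Proof.
set z0 := polar s0 t0 => H; exists (d * z0) => e e0.
(* Collects the two error terms: [2 * cabs z0] from the remainder of [f] and [cabs d * cabs z0] from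
   the remainder of [polar]. *)
set K := cabs d * cabs z0 + 2 * cabs z0 + 1.
have K0 : 0 < K by rewrite /K; have := mulr_ge0 (cabs_ge0 d) (cabs_ge0 z0); have := cabs_ge0 z0; lra.
set e1 := Num.min 1 (e / K).
have e10 : 0 < e1 by rewrite lt_min ltr01 divr_gt0.
have [r r0 {}H] := H _ e10.
have [r2 r20 H2] := polar_expansion e10.
have L0 : 0 < 2 * cabs z0 + 1 by have := cabs_ge0 z0; lra.
exists (Num.min r2 (r / (2 * cabs z0 + 1))); first by rewrite lt_min r20 divr_gt0.
move=> s t; rewrite lt_min => /andP[/H2 {}H2 st2].
set n := `|s - s0| + `|t - t0| in H2 st2 *.
have n0 : 0 <= n by rewrite addr_ge0.
have e11 : e1 <= 1 by rewrite /e1 ge_min lexx.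
have e1K : e1 * K <= e by rewrite -ler_pdivlMr// /e1 ge_min lexx orbT.
have E : polar s t - z0 = z0 * (polar (s - s0) (t - t0) - 1).
  by rewrite mulrBr mulr1 /z0 -polarD; congr (polar _ _ - _); lra.
set v : CC R := (s - s0) +i* (t - t0) in H2 *.
have vn : cabs v <= n by exact: cabs_le_ReIm.
have pz : cabs (polar s t - z0 - z0 * v) <= cabs z0 * (e1 * n).
  by rewrite E -mulrBr cabsM ler_wpM2l// cabs_ge0.
have pz2 : cabs (polar s t - z0) <= 2 * cabs z0 * n.
  have -> : polar s t - z0 = (polar s t - z0 - z0 * v) + z0 * v by rewrite subrK.
  rewrite (le_trans (cabsD _ _))// cabsM.
  have := cabs_ge0 z0; have : e1 * n <= n by rewrite ler_piMl.
  by move: pz vn; nra.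
have pr : cabs (polar s t - z0) < r.
  rewrite (le_lt_trans pz2)//; move: st2; rewrite ltr_pdivlMr//; nra.
have -> : f (polar s t) - f z0 - d * z0 * v =
  (f (polar s t) - f z0 - d * (polar s t - z0)) + d * (polar s t - z0 - z0 * v) by ring.
rewrite (le_trans (cabsD _ _))// cabsM.
have h1 := H _ pr.
have h2 : e1 * cabs (polar s t - z0) <= e1 * (2 * cabs z0 * n) by rewrite ler_pM2l.
have h3 : cabs d * cabs (polar s t - z0 - z0 * v) <= cabs d * (cabs z0 * (e1 * n)).
  by rewrite ler_wpM2l// cabs_ge0.
have h4 : e1 * K * n <= e * n by rewrite ler_wpM2r.
have h5 : 0 <= e1 * n by rewrite mulr_ge0// ltW.
apply: (le_trans _ h4); rewrite /K; lra.
Qed.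

End Polar.

(** * Goursat's lemma and circle means *)

Section Goursat.
Variable R : realType.
Implicit Types (g : R -> R -> CC R) (s t w h : R).

Let ii : CC R := 0 +i* 1.

Definition joint_continuous g := continuous (fun p : R * R => g p.1 p.2).

Lemma joint_continuous_l g t : joint_continuous g -> continuous (fun s => g s t).
Proof.
move=> cg s; apply: (@continuous_comp _ _ _ (fun s => (s, t)) (fun p => g p.1 p.2)); last exact: cg.
by move: s; apply: continuous_pairT => s; [exact: cvg_id|exact: cvg_cst].
Qed.

Lemma joint_continuous_r g s : joint_continuous g -> continuous (g s).
Proof.
move=> cg t; apply: (@continuous_comp _ _ _ (fun t => (s, t)) (fun p => g p.1 p.2)); last exact: cg.
by move: t; apply: continuous_pairT => t; [exact: cvg_cst|exact: cvg_id].
Qed.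

(* The integral of g over the positively oriented boundary of
   [s, s + w] x [t, t + h]. *)
Definition rectint g s t w h : CC R :=
  cint s (s + w) (fun x => g x t) - cint s (s + w) (fun x => g x (t + h))
  + (ii * cint t (t + h) (g (s + w)) - ii * cint t (t + h) (g s)).

Lemma rectint_split g s t w h : joint_continuous g -> 0 <= w -> 0 <= h ->
  rectint g s t (w + w) (h + h) =
  rectint g s t w h + rectint g (s + w) t w h
  + (rectint g s (t + h) w h + rectint g (s + w) (t + h) w h).
Proof.
move=> cg w0 h0; rewrite /rectint !addrA.
have S u : cint s (s + w + w) (fun x => g x u) = cint s (s + w) (fun x => g x u) + cint (s + w) (s + w + w) (fun x => g x u).
  by apply: cint_split; rewrite ?lerDl//; exact: joint_continuous_l.
have T u : cint t (t + h + h) (g u) = cint t (t + h) (g u) + cint (t + h) (t + h + h) (g u).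
  by apply: cint_split; rewrite ?lerDl//; exact: joint_continuous_r.
by rewrite !S !T; ring.
Qed.

(* The corner of a quarter on which P fails, if there is one. *)
Definition quarter (P : R -> R -> bool) w h (p : R * R) : R * R :=
  let: (s, t) := p in
  if ~~ P s t then (s, t) else
  if ~~ P (s + w) t then (s + w, t) else
  if ~~ P s (t + h) then (s, t + h) else (s + w, t + h).

Lemma quarterE P w h s t : 0 <= w -> 0 <= h -> exists a b : R,
  [/\ quarter P w h (s, t) = (s + a, t + b), 0 <= a <= w & 0 <= b <= h].
Proof.
move=> w0 h0; rewrite /quarter.
case: ifP => _; first by exists 0, 0; rewrite !addr0 lexx w0 h0.
case: ifP => _; first by exists w, 0; rewrite !addr0 !lexx w0 h0.
case: ifP => _; first by exists 0, h; rewrite !addr0 !lexx w0 h0.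
by exists w, h; rewrite !lexx w0 h0.
Qed.

(** The intervals from [a n] to [a n + w / 2 ^+ n] are nested, so the supremum of their left ends
    belongs to all of them. *)
Lemma nested_limit (a : nat -> R) (w : R) : 0 <= w ->
  (forall n, a n <= a n.+1 <= a n + w / 2 ^+ n.+1) ->
  exists l, forall n, a n <= l <= a n + w / 2 ^+ n.
Proof.
move=> w0 H.
have M n k : a n <= a (k + n)%N /\ a (k + n)%N + w / 2 ^+ (k + n) <= a n + w / 2 ^+ n.
  elim: k => [|k [IH1 IH2]]; first by rewrite add0n.
  have /andP[h1 h2] := H (k + n)%N; rewrite addSn; split; first exact: le_trans h1.
  apply: le_trans IH2.
  have -> : w / 2 ^+ (k + n) = w / 2 ^+ (k + n).+1 + w / 2 ^+ (k + n).+1.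
    rewrite exprS; field; exact: expf_neq0.
  lra.
have Q n : 0 <= w / 2 ^+ n by rewrite divr_ge0// exprn_ge0.
have U m n : a m <= a n + w / 2 ^+ n.
  have [mn|nm] := leqP m n.
    have [h _] := M m (n - m)%N; rewrite subnK// in h.
    by have := Q n; lra.
  have [_ h] := M n (m - n)%N; rewrite subnK in h; last exact: ltnW.
  by have := Q m; lra.
have hs : has_sup (range a).
  split; first by exists (a 0%N), 0%N.
  by exists (a 0%N + w / 2 ^+ 0) => _ [m _ <-]; exact: U.
exists (sup (range a)) => n; apply/andP; split.
  by apply: ub_le_sup; [case: hs|exists n].
apply: ge_sup; first by case: hs.
by move=> _ [m _ <-]; exact: U.
Qed.

(** Direct computation on the four sides. Subtracting a first-order expansion therefore leaves a
    rectangle integral unchanged. *)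
Lemma rectint_affine (c A : CC R) s0 t0 s t w h : 0 <= w -> 0 <= h ->
  rectint (fun x y => c + A * ((x - s0) +i* (y - t0))) s t w h = 0.
Proof.
move=> w0 h0.
have sw : s <= s + w by rewrite lerDl.
have th : t <= t + h by rewrite lerDl.
have cC : continuous (fun x : R => x%:C : CC R).
  by move=> x; apply: cvg_complex; [exact: cvg_id|exact: cvg_cst].
have cM (B : CC R) : continuous (fun x : R => B * (x%:C : CC R)).
  by move=> x; apply: cvgM; [exact: cvg_cst|exact: cC].
have cc (B : CC R) : continuous (fun _ : R => B) by move=> x; exact: cvg_cst.
have HS u : cint s (s + w) (fun x => c + A * ((x - s0) +i* (u - t0))) =
    (c - A * (s0%:C : CC R) + A * ii * ((u - t0)%:C : CC R)) * (w%:C : CC R) +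
    A * ((((s + w) ^+ 2 - s ^+ 2) / 2)%:C : CC R).
  set B := c - _ + _.
  have -> : cint s (s + w) (fun x => c + A * ((x - s0) +i* (u - t0))) =
      cint s (s + w) (fun x => B + A * (x%:C : CC R)).
    apply: eq_cint => x _.
    have -> : ((x - s0) +i* (u - t0) : CC R) = x%:C - s0%:C + ii * (u - t0)%:C.
      by apply/eqP; rewrite eq_complex /=; apply/andP; split; apply/eqP; ring.
    by rewrite /B; ring.
  rewrite (cintD _ _ (cc B) (cM A)) (cint_cst B sw) (cintZ _ _ A cC) (cint_id sw).
  by have -> : s + w - s = w by rewrite addrC addKr.
have HT u : cint t (t + h) (fun y => c + A * ((u - s0) +i* (y - t0))) =
    (c + A * ((u - s0)%:C : CC R) - A * ii * (t0%:C : CC R)) * (h%:C : CC R) +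
    A * ii * ((((t + h) ^+ 2 - t ^+ 2) / 2)%:C : CC R).
  set B := c + _ - _.
  have -> : cint t (t + h) (fun y => c + A * ((u - s0) +i* (y - t0))) =
      cint t (t + h) (fun y => B + A * ii * (y%:C : CC R)).
    apply: eq_cint => x _.
    have -> : ((u - s0) +i* (x - t0) : CC R) = (u - s0)%:C + ii * x%:C - ii * t0%:C.
      by apply/eqP; rewrite eq_complex /=; apply/andP; split; apply/eqP; ring.
    by rewrite /B; ring.
  rewrite (cintD _ _ (cc B) (cM (A * ii))) (cint_cst B th) (cintZ _ _ (A * ii) cC) (cint_id th).
  by have -> : t + h - t = h by rewrite addrC addKr.
rewrite /rectint !HS !HT.
have E1 : ((t + h - t0)%:C : CC R) = (t - t0)%:C + h%:C by rewrite -rmorphD /=; congr (_%:C); lra.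
have E2 : ((s + w - s0)%:C : CC R) = (s - s0)%:C + w%:C by rewrite -rmorphD /=; congr (_%:C); lra.
rewrite E1 E2; ring.
Qed.

Lemma rectintB g g' s t w h : joint_continuous g -> joint_continuous g' ->
  rectint (fun x y => g x y - g' x y) s t w h = rectint g s t w h - rectint g' s t w h.
Proof.
move=> cg cg'; rewrite /rectint !cintB; try exact: joint_continuous_l; try exact: joint_continuous_r.
ring.
Qed.

(** The constant 4 is 2 for the pair of opposite sides times the 2 of [cint_le]. *)
Lemma rectint_le g s t w h M : joint_continuous g -> 0 <= w -> 0 <= h ->
  (forall x y, s <= x <= s + w -> t <= y <= t + h -> cabs (g x y) <= M) ->
  cabs (rectint g s t w h) <= 4 * M * (w + h).
Proof.
move=> cg w0 h0 gM; rewrite /rectint.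
have sw : s <= s + w by rewrite lerDl.
have th : t <= t + h by rewrite lerDl.
have i1 : cabs ii = 1 by rewrite cabs_iE expr0n /= add0r expr1n sqrtr1.
have HS u : t <= u <= t + h -> cabs (cint s (s + w) (fun x => g x u)) <= 2 * M * w.
  move=> hu; rewrite -[X in _ <= 2 * M * X](_ : s + w - s = w); last by lra.
  by apply: cint_le => //; [exact: joint_continuous_l|move=> x hx; exact: gM].
have HT u : s <= u <= s + w -> cabs (cint t (t + h) (g u)) <= 2 * M * h.
  move=> hu; rewrite -[X in _ <= 2 * M * X](_ : t + h - t = h); last by lra.
  by apply: cint_le => //; [exact: joint_continuous_r|move=> x hx; exact: gM].
apply: (le_trans (cabsD _ _)); apply: (le_trans (lerD (cabsB _ _) (cabsB _ _))).
rewrite !cabsM i1 !mul1r.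
have := HS t; have := HS (t + h); have := HT s; have := HT (s + w).
rewrite !lexx sw th => /(_ isT) ? /(_ isT) ? /(_ isT) ? /(_ isT) ?; lra.
Qed.

(* Both sides of the bound are additive under quadrisection, so a failure would
   propagate to arbitrarily small rectangles around a point of differentiability. *)
Lemma goursat_approx g s0 t0 w h (e : R) : joint_continuous g -> 0 <= w -> 0 <= h -> 0 < e ->
  (forall s t, s0 <= s <= s0 + w -> t0 <= t <= t0 + h -> plane_diff g s t) ->
  cabs (rectint g s0 t0 w h) <= e * (w + h) ^+ 2.
Proof.
move=> cg w0 h0 e0 dg; apply/negPn/negP => bad.
(* [P n] is the desired bound for a rectangle of generation [n], and [p n] is the lower left corner
   of the bad rectangle kept at that generation. *)
pose P n s t := cabs (rectint g s t (w / 2 ^+ n) (h / 2 ^+ n)) <= e * (w / 2 ^+ n + h / 2 ^+ n) ^+ 2.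
pose p := fix p n := if n is m.+1 then quarter (P m.+1) (w / 2 ^+ m.+1) (h / 2 ^+ m.+1) (p m) else (s0, t0).
have Q (x : R) n : 0 <= x -> 0 <= x / 2 ^+ n by move=> x0; rewrite divr_ge0// exprn_ge0.
have half (x : R) n : x / 2 ^+ n = x / 2 ^+ n.+1 + x / 2 ^+ n.+1.
  rewrite exprS; field; exact: expf_neq0.
have badn n : ~~ P n (p n).1 (p n).2.
  elim: n => [|n IH]; first by rewrite /P /= !divr1.
  move: IH => /=; case: (p n) => s t /= IH; rewrite /quarter.
  case: ifP => //; move/negbFE => h1; case: ifP => //; move/negbFE => h2.
  case: ifP => //; move/negbFE => h3 /=; apply/negP => h4; move/negP: IH; apply.
  move: h1 h2 h3 h4; rewrite /P => h1 h2 h3 h4.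
  rewrite (half w) (half h) rectint_split; [|exact: cg|exact: Q|exact: Q].
  apply: (le_trans (cabsD _ _)); apply: (le_trans (lerD (cabsD _ _) (cabsD _ _))).
  lra.
have step n : (p n).1 <= (p n.+1).1 <= (p n).1 + w / 2 ^+ n.+1 /\
              (p n).2 <= (p n.+1).2 <= (p n).2 + h / 2 ^+ n.+1.
  move=> /=; case: (p n) => s t.
  have [a [b [-> /andP[a0 aw] /andP[b0 bh]]]] := quarterE (P n.+1) s t (Q w n.+1 w0) (Q h n.+1 h0).
  by rewrite /= !lerDl !lerD2l a0 aw b0 bh.
have [s Hs] := nested_limit w0 (fun n => (step n).1).
have [t Ht] := nested_limit h0 (fun n => (step n).2).
have [A HA] : plane_diff g s t.
  by apply: dg; [have := Hs 0%N|have := Ht 0%N]; rewrite /= divr1.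
have e40 : 0 < e / 4 by rewrite divr_gt0.
have [d d0 {}HA] := HA _ e40.
have [n Hn] : exists n : nat, w / 2 ^+ n + h / 2 ^+ n < d.
  have : (fun n => (w + h) * 2^-1 ^+ n) @ \oo --> (w + h) * 0.
    apply: cvgM; first exact: cvg_cst.
    by apply: cvg_expr; rewrite ger0_norm// invf_lt1// ltr1n.
  rewrite mulr0 => /cvgrPdist_lt/(_ _ d0) [n _ /(_ n (leqnn n))] /=.
  rewrite sub0r normrN ger0_norm; last by rewrite mulr_ge0 ?addr_ge0// exprn_ge0.
  by rewrite mulrDl exprVn => hn; exists n.
move: (badn n) (Hs n) (Ht n); rewrite /P; case: (p n) => sn tn; rewrite [(sn, tn).1]/= [(sn, tn).2]/=.
have wn0 : 0 <= w / 2 ^+ n by exact: Q.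
have hn0 : 0 <= h / 2 ^+ n by exact: Q.
move: (w / 2 ^+ n) (h / 2 ^+ n) wn0 hn0 Hn => wn hn wn0 hn0 Hn /negP + Hsn Htn; apply.
(* Only the remainder after the expansion at the limit point contributes. On a rectangle smaller
   than [d] it is at most [e / 4 * (wn + hn)], and the 4 cancels against [rectint_le], contradicting
   badness. *)
pose aff (x y : R) : CC R := g s t + A * ((x - s) +i* (y - t)).
have caff : joint_continuous aff.
  move=> q; apply: cvgD; first exact: cvg_cst.
  apply: cvgM; first exact: cvg_cst.
  by apply: cvg_complex; apply: cvgB; [exact: cvg_fst|exact: cvg_cst|exact: cvg_snd|exact: cvg_cst].
have -> : rectint g sn tn wn hn = rectint (fun x y => g x y - aff x y) sn tn wn hn.
  by rewrite rectintB// rectint_affine// subr0.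
have -> : e * (wn + hn) ^+ 2 = 4 * (e / 4 * (wn + hn)) * (wn + hn) by field.
have cga : joint_continuous (fun x y => g x y - aff x y).
  by move=> q; apply: cvgB; [exact: cg|exact: caff].
apply: (rectint_le cga wn0 hn0) => x y hx hy; rewrite /aff opprD addrA.
have nxy : `|x - s| + `|y - t| <= wn + hn.
  by apply: lerD; rewrite ler_norml; lra.
apply: (le_trans (HA _ _ _)); first lra.
by rewrite ler_pM2l.
Qed.

Lemma goursat g s0 t0 w h : joint_continuous g -> 0 <= w -> 0 <= h ->
  (forall s t, s0 <= s <= s0 + w -> t0 <= t <= t0 + h -> plane_diff g s t) ->
  rectint g s0 t0 w h = 0.
Proof.
move=> cg w0 h0 dg; apply/eqP; rewrite -cabs_eq0 eq_le cabs_ge0 andbT.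
apply/ler_addgt0Pl => e e0; rewrite addr0.
have K : 0 < (w + h) ^+ 2 + 1 by have := sqr_ge0 (w + h); lra.
apply: (le_trans (@goursat_approx _ _ _ _ _ (e / ((w + h) ^+ 2 + 1)) cg w0 h0 _ dg)).
  by rewrite divr_gt0.
by rewrite mulrAC ler_pdivrMr// ler_pM2l//; lra.
Qed.

(** Integration is in the angle, so this is [2 pi] times the mean of [f] over the circle; at [r = 0]
    it is [2 pi] times [f 0]. *)
Definition circint (f : CC R -> CC R) (r : R) : CC R :=
  cint 0 (pi *+ 2) (fun t => f ((r%:C : CC R) * cis t)).

Lemma continuous_circle (T : topologicalType) (f : CC R -> CC R) (u : T -> R) (v : T -> R) :
  continuous f -> continuous u -> continuous v ->
  continuous (fun q => f (((u q)%:C : CC R) * cis (v q))).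
Proof.
move=> cf cu cv q.
apply: (@continuous_comp _ _ _ (fun q => ((u q)%:C : CC R) * cis (v q)) f); last exact: cf.
apply: cvgM; first by apply: cvg_complex; [exact: cu|exact: cvg_cst].
apply: (@continuous_comp _ _ _ v (@cis R)); [exact: cv|exact: continuous_cis].
Qed.

Lemma continuous_circint (f : CC R -> CC R) : continuous f -> continuous (circint f).
Proof.
move=> cf; apply: (@continuous_cint R R 0 (pi *+ 2) (fun r t => f ((r%:C : CC R) * cis t))).
  by rewrite mulrn_wge0// pi_ge0.
by apply: continuous_circle => // q; [exact: cvg_fst|exact: cvg_snd].
Qed.

(** Goursat's lemma for [f] composed with [polar] on the rectangle from [ln r1] to [ln r2] and from
    0 to [2 pi]: the horizontal sides cancel by periodicity and the vertical sides are the two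
    circle integrals. *)
Lemma circint_eq_open (f : CC R -> CC R) (r1 r2 : R) : continuous f -> 0 < r1 -> r1 <= r2 ->
  (forall z, r1 <= cabs z <= r2 -> exists d, cdiff f z d) ->
  circint f r1 = circint f r2.
Proof.
move=> cf r10 r12 df; have r20 : 0 < r2 by exact: lt_le_trans r12.
pose g s t := f (polar s t).
have cg : joint_continuous g.
  apply: (@continuous_circle (R * R)%type f (fun q => expR q.1) (fun q => q.2)) => // q.
    apply: (@continuous_comp _ _ _ fst expR); [exact: cvg_fst|exact: continuous_expR].
  exact: cvg_snd.
have w0 : 0 <= ln r2 - ln r1 by rewrite subr_ge0 ler_ln ?posrE.
have h0 : 0 <= pi *+ 2 :> R by rewrite mulrn_wge0// pi_ge0.
have := @goursat g (ln r1) 0 _ _ cg w0 h0.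
rewrite /rectint addrC subrK add0r.
have -> : (fun x => g x (pi *+ 2)) = (fun x => g x 0).
  by apply/funext => x; rewrite /g /polar cis2pi cis0.
rewrite subrr add0r => H.
have {}H : ii * cint 0 (pi *+ 2) (g (ln r2)) - ii * cint 0 (pi *+ 2) (g (ln r1)) = 0.
  apply: H => s t /andP[s1 s2] _.
  have [|d Hd] := df (polar s t); last exact: polar_plane_diff Hd.
  rewrite cabs_polar -{1}(lnK r10) -{1}(lnK r20) !ler_expR; lra.
have ii0 : ii != 0 by rewrite -cabs_eq0 cabs_iE expr0n /= add0r expr1n sqrtr1 oner_eq0.
move/eqP: H; rewrite -mulrBr mulf_eq0 (negbTE ii0) subr_eq0 => /eqP E.
rewrite /circint; apply/esym.
by move: E; rewrite /g /polar !lnK.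
Qed.

Lemma closed_interval_cst (phi : R -> CC R) (a b : R) : continuous phi -> a < b ->
  (forall x y, a < x -> x <= y -> y < b -> phi x = phi y) -> phi a = phi b.
Proof.
move=> cphi ab H; apply/eqP; rewrite -subr_eq0 -cabs_eq0 eq_le cabs_ge0 andbT.
apply/ler_addgt0Pl => e e0; rewrite addr0.
have e20 : 0 < e / 2 by rewrite divr_gt0.
have /cvg_cabsP/(_ _ e20)/nbhs_ballP[d1 /= d10 H1] := cphi a.
have /cvg_cabsP/(_ _ e20)/nbhs_ballP[d2 /= d20 H2] := cphi b.
pose m := Num.min ((b - a) / 2) (Num.min (d1 / 2) (d2 / 2)).
have m0 : 0 < m by rewrite !lt_min; lra.
have [m1 m2 m3] : [/\ m <= (b - a) / 2, m <= d1 / 2 & m <= d2 / 2].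
  by rewrite /m !ge_min !lexx !orbT.
have h1 : cabs (phi (a + m) - phi a) < e / 2.
  by apply: H1; rewrite /ball /= ltr_norml; lra.
have h2 : cabs (phi (b - m) - phi b) < e / 2.
  by apply: H2; rewrite /ball /= ltr_norml; lra.
have E : phi (a + m) = phi (b - m) by apply: H; lra.
have -> : phi a - phi b = (phi (b - m) - phi b) - (phi (a + m) - phi a) by rewrite E; ring.
by rewrite (le_trans (cabsB _ _))//; lra.
Qed.

(** A limit in the radius at both ends admits [r1 = 0] and boundary circles that pass through a
    singular point. *)
Lemma circint_eq (f : CC R -> CC R) (r1 r2 : R) : continuous f -> 0 <= r1 -> r1 < r2 ->
  (forall z, r1 < cabs z < r2 -> exists d, cdiff f z d) ->
  circint f r1 = circint f r2.
Proof.
move=> cf r10 r12 df; apply: closed_interval_cst => //; first exact: continuous_circint.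
move=> x y r1x xy yr2; apply: circint_eq_open => //; first exact: le_lt_trans r1x.
by move=> z /andP[zx zy]; apply: df; lra.
Qed.

End Goursat.

(** * Cauchy's formula and power series expansions on a disc *)

Section CauchySeries.
Variable R : realType.
Implicit Types (f : CC R -> CC R) (z w : CC R) (r M : R).

Let tau : R := pi *+ 2.

Let tau_gt0 : 0 < tau.
Proof. by rewrite mulrn_wgt0// pi_gt0. Qed.

Lemma le0_geometric (x C q : R) : 0 <= q < 1 -> (forall n : nat, x <= C * q ^+ n) -> x <= 0.
Proof.
move=> /andP[q0 q1] H; rewrite leNgt; apply/negP => x0.
have : (fun n => C * q ^+ n) @ \oo --> C * 0.
  by apply: cvgM; [exact: cvg_cst|apply: cvg_expr; rewrite ger0_norm].
rewrite mulr0 => /cvgrPdist_lt/(_ _ x0) [n _ /(_ n (leqnn n))] /=.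
rewrite sub0r normrN => h; have := H n; have := ler_norm (C * q ^+ n); lra.
Qed.

Lemma cdiff_near_eq f g z d (r : R) : 0 < r -> (forall w, cabs (w - z) < r -> f w = g w) ->
  cdiff f z d -> cdiff g z d.
Proof.
move=> r0 fg H e e0; have [s s0 {}H] := H e e0.
exists (Num.min r s); first by rewrite lt_min r0.
move=> w; rewrite lt_min => /andP[wr ws]; rewrite -!fg//; first exact: H.
by rewrite subrr cabs0.
Qed.

(** The value [d] at [z] makes the quotient continuous there when [d] is the derivative of [f] at
    [z]. *)
Definition diff_quotient f z d : CC R -> CC R :=
  fun w => if w == z then d else (f w - f z) / (w - z).

Lemma cdiff_diff_quotient f z d w : w != z -> (exists d', cdiff f w d') ->
  exists d', cdiff (fun u => u * diff_quotient f z d u) w d'.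
Proof.
move=> wz [d' /cdiff_is_derive fd].
have wz0 : 0 < cabs (w - z) by rewrite cabs_gt0 subr_eq0.
have D : derivable (fun u : CC R => u * ((f u - f z) * (u - z)^-1)) w (1 : CC R).
  apply: derivableM; first exact: derivable_id.
  apply: derivableM; first by apply: derivableB; [have [] := fd|exact: derivable_cst].
  apply: derivableV; first by rewrite subr_eq0.
  by apply: derivableB; [exact: derivable_id|exact: derivable_cst].
exists ('D_1 (fun u : CC R => u * ((f u - f z) * (u - z)^-1)) w).
apply: (@cdiff_near_eq (fun u : CC R => u * ((f u - f z) * (u - z)^-1)) _ _ _ (cabs (w - z))) => //.
  move=> u uw; rewrite /diff_quotient; case: eqP => // uz; move: uw.
  by rewrite uz cabs_dist ltxx.
by apply: is_derive_cdiff; exact: derivableP.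
Qed.

Lemma continuous_diff_quotient f z d : continuous f -> cdiff f z d -> continuous (diff_quotient f z d).
Proof.
move=> cf fd w; have [->|wz] := eqVneq w z.
  apply: (proj2 (cvg_cabsP (nbhs_filter z) _ _)) => e e0.
  have e20 : 0 < e / 2 by rewrite divr_gt0.
  have [r r0 H] := fd _ e20; apply/nbhs_cabsP; exists r => // u ur.
  rewrite /diff_quotient eqxx; case: eqP => [_|/eqP uz]; first by rewrite subrr cabs0.
  have uz0 : u - z != 0 by rewrite subr_eq0.
  have -> : (f u - f z) / (u - z) - d = (f u - f z - d * (u - z)) / (u - z).
    by rewrite [RHS]mulrBl mulfK.
  rewrite cabsM cabsV ltr_pdivrMr ?cabs_gt0//.
  by apply: (le_lt_trans (H _ ur)); rewrite ltr_pM2r ?cabs_gt0//; lra.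
have wz0 : 0 < cabs (w - z) by rewrite cabs_gt0 subr_eq0.
have C1 : (fun u : CC R => f u - f z) @ w --> f w - f z.
  have cfw : f @ w --> f w := cf w.
  exact: (cvgB cfw (cvg_cst (f z))).
have C2 : (fun u : CC R => u - z) @ w --> w - z.
  exact: (cvgB (@cvg_id _ (nbhs w)) (cvg_cst z)).
have C3 : (fun u : CC R => (u - z)^-1) @ w --> (w - z)^-1.
  have wz1 : w - z != 0 by rewrite subr_eq0.
  exact: (cvgV wz1 C2).
have C : (fun u : CC R => (f u - f z) * (u - z)^-1) @ w --> (f w - f z) * (w - z)^-1.
  exact: cvgM C1 C3.
apply: (proj2 (cvg_cabsP (nbhs_filter w) _ _)) => e e0.
have /nbhs_cabsP[r r0 H] := proj1 (cvg_cabsP (nbhs_filter w) _ _) C e e0.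
apply/nbhs_cabsP; exists (Num.min r (cabs (w - z))); first by rewrite lt_min r0.
move=> u; rewrite lt_min => /andP[ur uw]; rewrite /diff_quotient (negbTE wz); case: eqP => [uz|_].
  by move: uw; rewrite uz cabs_dist ltxx.
exact: H.
Qed.

(** Orthogonality on the circle. For a positive exponent [m] the components of the integrand have
    the periodic antiderivatives [sin (m t) / m] and [cos (m t) / m]. *)
Lemma cint_cisVX k : cint 0 tau (fun t => (cis t)^-1 ^+ k) = if k == 0%N then (tau%:C : CC R) else 0.
Proof.
case: k => [|k] /=.
  rewrite (eq_cint (k := fun=> 1)); last by move=> t _; rewrite expr0.
  by rewrite cint_cst ?(ltW tau_gt0)// mul1r subr0.
rewrite /cint.
have k0 : (k.+1%:R : R) != 0 by rewrite pnatr_eq0.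
have E t : (cis t)^-1 ^+ k.+1 = cos (k.+1%:R * t) +i* (- sin (k.+1%:R * t)) :> CC R.
  by rewrite cisV cisX mulrN /cis cosN sinN.
have st : sin (k.+1%:R * tau) = 0 :> R /\ cos (k.+1%:R * tau) = 1 :> R.
  have : cis (k.+1%:R * tau) = 1 by rewrite -cisX cis2pi expr1n.
  by move=> /eqP; rewrite eq_complex /= => /andP[/eqP -> /eqP ->].
have ck : continuous (fun t : R => k.+1%:R * t).
  by move=> t; apply: cvgM; [exact: cvg_cst|exact: cvg_id].
have Dc (t : R) : is_derive t (1 : R) (fun t => sin (k.+1%:R * t) / k.+1%:R) (cos (k.+1%:R * t)).
  have D1 : is_derive t (1 : R) (fun t => k.+1%:R * t) k.+1%:R.
    by apply: is_derive_eq; rewrite /GRing.scale /= mulr1.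
  have D2 := is_derive1_comp (is_derive_sin (k.+1%:R * t)) D1.
  have -> : (fun t => sin (k.+1%:R * t) / k.+1%:R) = (k.+1%:R)^-1 \*: ((sin \o (fun t => k.+1%:R * t)) : R -> R).
    by apply: funext => u; rewrite /= mulrC.
  by apply: is_derive_eq; rewrite /GRing.scale /=; field.
have Ds (t : R) : is_derive t (1 : R) (fun t => cos (k.+1%:R * t) / k.+1%:R) (- sin (k.+1%:R * t)).
  have D1 : is_derive t (1 : R) (fun t => k.+1%:R * t) k.+1%:R.
    by apply: is_derive_eq; rewrite /GRing.scale /= mulr1.
  have D2 := is_derive1_comp (is_derive_cos (k.+1%:R * t)) D1.
  have -> : (fun t => cos (k.+1%:R * t) / k.+1%:R) = (k.+1%:R)^-1 \*: ((cos \o (fun t => k.+1%:R * t)) : R -> R).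
    by apply: funext => u; rewrite /= mulrC.
  by apply: is_derive_eq; rewrite /GRing.scale /=; field.
under eq_Rintegral do rewrite E /=.
under [X in _ +i* X]eq_Rintegral do rewrite E /=.
have [s1 c1] := st.
congr (_ +i* _).
  rewrite (Rintegral_itv_derive (ltW tau_gt0) _ Dc); first by rewrite s1 mulr0 sin0 !mul0r subrr.
  by move=> t; apply: (@continuous_comp _ _ _ _ cos); [exact: ck|exact: continuous_cos].
rewrite (Rintegral_itv_derive (ltW tau_gt0) _ Ds); first by rewrite c1 mulr0 cos0 subrr.
move=> t; apply: cvgN.
by apply: (@continuous_comp _ _ _ _ sin); [exact: ck|exact: continuous_sin].
Qed.

Definition circ (r t : R) : CC R := (r%:C : CC R) * cis t.

Lemma cabs_circ r t : 0 <= r -> cabs (circ r t) = r.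
Proof. by move=> r0; rewrite cabsM cabs_cis mulr1 cabs_real ger0_norm. Qed.

Lemma circ_neq0 r t : 0 < r -> circ r t != 0.
Proof. by move=> r0; rewrite -cabs_gt0 cabs_circ// ltW. Qed.

Lemma continuous_circ r : continuous (circ r).
Proof.
by apply: (@continuous_circle _ R id (fun=> r) id) => // t; [exact: cvg_id|exact: cvg_cst|exact: cvg_id].
Qed.

Lemma continuous_circV r : 0 < r -> continuous (fun t => (circ r t)^-1).
Proof. by move=> r0 t; apply: cvgV; [exact: circ_neq0|exact: continuous_circ]. Qed.

Lemma continuous_mulc (T : topologicalType) (g h : T -> CC R) : continuous g -> continuous h ->
  continuous (fun t => g t * h t).
Proof. by move=> cg ch t; apply: cvgM; [exact: cg|exact: ch]. Qed.

Lemma continuous_expc (T : topologicalType) (g : T -> CC R) n : continuous g ->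
  continuous (fun t => g t ^+ n).
Proof.
move=> cg; elim: n => [|n IH].
  by under eq_fun do rewrite expr0; move=> t; exact: cvg_cst.
by under eq_fun do rewrite exprS; exact: continuous_mulc.
Qed.

Lemma kernel_lower z r t : cabs z < r -> 1 - cabs z / r <= cabs (1 - z / circ r t).
Proof.
move=> zr; have r0 : 0 < r by exact: le_lt_trans (cabs_ge0 z) zr.
have := cabs_leB 1 (z / circ r t).
by rewrite cabs1 cabsM cabsV cabs_circ// ltW.
Qed.

Lemma ratio_bounds z r : cabs z < r -> 0 <= cabs z / r < 1.
Proof.
move=> zr; have r0 : 0 < r by exact: le_lt_trans (cabs_ge0 z) zr.
by rewrite divr_ge0 ?cabs_ge0 1?ltW//= ltr_pdivrMr// mul1r.
Qed.

Lemma kernel_neq0 z r t : cabs z < r -> 1 - z / circ r t != 0.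
Proof.
move=> zr; rewrite -cabs_gt0 (lt_le_trans _ (kernel_lower t zr))//.
by have := ratio_bounds zr; lra.
Qed.

Lemma continuous_kernel z r : cabs z < r -> continuous (fun t => (1 - z / circ r t)^-1).
Proof.
move=> zr t; have r0 : 0 < r by exact: le_lt_trans (cabs_ge0 z) zr.
apply: cvgV; first exact: kernel_neq0.
apply: cvgB; first exact: cvg_cst.
by apply: cvgM; [exact: cvg_cst|exact: continuous_circV].
Qed.

(** For [zeta = circ r t] one has [d zeta / (zeta - z) = i dt / (1 - z / zeta)], so this is Cauchy's
    kernel in the angle variable. Its geometric expansion leaves the remainder
    [(z / zeta)^n / (1 - z / zeta)] after [n] terms. *)
Lemma kernel_series (h : R -> CC R) z r M n : continuous h -> cabs z < r ->
  (forall t, cabs (h t) <= M) ->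
  cabs (cint 0 tau (fun t => h t / (1 - z / circ r t)) -
        \sum_(k < n) z ^+ k * cint 0 tau (fun t => h t * (circ r t)^-1 ^+ k))
  <= 2 * M * tau * ((cabs z / r) ^+ n / (1 - cabs z / r)).
Proof.
move=> ch zr hM; have r0 : 0 < r by exact: le_lt_trans (cabs_ge0 z) zr.
have qb := ratio_bounds zr; set q := cabs z / r in qb *.
have cV := continuous_circV r0.
have chk k : continuous (fun t => h t * (circ r t)^-1 ^+ k).
  by apply: continuous_mulc; [exact: ch|exact: continuous_expc].
have chz k : continuous (fun t => z ^+ k * (h t * (circ r t)^-1 ^+ k)).
  by apply: continuous_mulc; [move=> t; exact: cvg_cst|exact: chk].
rewrite (eq_bigr (fun k : 'I_n => cint 0 tau (fun t => z ^+ k * (h t * (circ r t)^-1 ^+ k)))); last first.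
  by move=> k _; rewrite (cintZ _ _ _ (chk k)).
rewrite -(cint_sum 0 tau n chz).
have ck : continuous (fun t => h t / (1 - z / circ r t)).
  by apply: continuous_mulc; [exact: ch|exact: continuous_kernel].
have cs := @continuous_csum R n _ chz.
rewrite -(cintB _ _ ck cs).
have -> : 2 * M * tau * (q ^+ n / (1 - q)) = 2 * (M * (q ^+ n / (1 - q))) * (tau - 0) by rewrite subr0; ring.
have cks : continuous (fun t => h t / (1 - z / circ r t) - \sum_(k < n) z ^+ k * (h t * (circ r t)^-1 ^+ k)).
  by move=> t; apply: cvgB; [exact: ck|exact: cs].
apply: (cint_le cks (ltW tau_gt0)) => t _.
have -> : \sum_(k < n) z ^+ k * (h t * (circ r t)^-1 ^+ k) = h t * \sum_(k < n) (z / circ r t) ^+ k.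
  by rewrite mulr_sumr; apply: eq_bigr => k _; rewrite exprMn; ring.
have -> : h t / (1 - z / circ r t) - h t * \sum_(k < n) (z / circ r t) ^+ k =
    h t * ((z / circ r t) ^+ n / (1 - z / circ r t)).
  have k0 := kernel_neq0 t zr; rewrite -mulrBr; congr (_ * _).
  apply: (mulIf k0); rewrite mulrBl mulVf// divfK//.
  have := subrX1 (z / circ r t) n => E.
  have -> : (\sum_(k < n) (z / circ r t) ^+ k) * (1 - z / circ r t) = 1 - (z / circ r t) ^+ n.
    by rewrite -[RHS]opprB E; ring.
  by rewrite opprB addrC subrK.
rewrite cabsM; apply: ler_pM; rewrite ?cabs_ge0//.
rewrite cabsM cabsV cabsX cabsM cabsV cabs_circ ?(ltW r0)//.
apply: ler_wpM2l; first by rewrite exprn_ge0//; case/andP: qb.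
have := kernel_lower t zr; rewrite -/q => hq.
have p1 : 0 < 1 - q by case/andP: qb => _ q1; rewrite subr_gt0.
by rewrite lef_pV2 ?posrE// (lt_le_trans p1).
Qed.

(** In the geometric expansion only the constant term has a nonzero integral, and the truncation
    error tends to 0. *)
Lemma kernel_mean z r : cabs z < r -> cint 0 tau (fun t => (1 - z / circ r t)^-1) = (tau%:C : CC R).
Proof.
move=> zr; have r0 : 0 < r by exact: le_lt_trans (cabs_ge0 z) zr.
have qb := ratio_bounds zr.
have c1 : continuous (fun _ : R => 1 : CC R) by move=> t; exact: cvg_cst.
apply/eqP; rewrite -subr_eq0 -cabs_eq0 eq_le cabs_ge0 andbT.
apply: (@le0_geometric _ (2 * 1 * tau * ((cabs z / r) / (1 - cabs z / r))) _ qb) => n.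
(* With [n.+1] terms the constant one is always present and can be split off. *)
have := @kernel_series (fun=> 1) z r 1 n.+1 c1 zr; rewrite cabs1 => /(_ (fun=> lexx _)).
rewrite (eq_cint (h := fun t => 1 / _) (k := fun t => (1 - z / circ r t)^-1)); last first.
  by move=> t _; rewrite mul1r.
rewrite big_ord_recl big1.
  have -> : cint 0 tau (fun t => 1 * (circ r t)^-1 ^+ (@ord0 n)) = tau%:C.
    rewrite -[RHS](cint_cisVX 0); apply: eq_cint => t _.
    by rewrite mul1r !expr0.
  rewrite expr0 mul1r addr0 exprS; lra.
move=> i _; rewrite (eq_cint (h := fun t => 1 * (circ r t)^-1 ^+ (lift ord0 i)) (k := fun t => (r%:C)^-1 ^+ (lift ord0 i) * (cis t)^-1 ^+ (lift ord0 i))); last first.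
  by move=> t _; rewrite mul1r /circ invfM exprMn.
rewrite cintZ; last first.
  apply: continuous_expc; under eq_fun do rewrite cisV.
  by move=> t; apply: (@continuous_comp _ _ _ -%R (@cis R)); [exact: opp_continuous|exact: continuous_cis].
by rewrite cint_cisVX /= !mulr0.
Qed.

Lemma cauchy_formula f z r : continuous f -> cabs z < r ->
  (forall w, cabs w < r -> exists d, cdiff f w d) ->
  cint 0 tau (fun t => f (circ r t) / (1 - z / circ r t)) = f z * (tau%:C : CC R).
Proof.
move=> cf zr df; have r0 : 0 < r by exact: le_lt_trans (cabs_ge0 z) zr.
have [d fd] := df z zr.
(* On the circle of radius [r] this is [(f u - f z) / (1 - z / u)], so a zero circle integral
   combined with [kernel_mean] is the claim. *)
pose G u := u * diff_quotient f z d u.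
have cG : continuous G.
  by apply: continuous_mulc; [move=> u; exact: cvg_id|exact: continuous_diff_quotient].
have G0 : circint G 0 = 0.
  rewrite /circint (eq_cint (k := fun=> 0)) ?cint0// => t _.
  by rewrite /G -[X in X * cis t]/(0 : CC R) !mul0r.
have dG w : w != z -> cabs w < r -> exists d', cdiff G w d'.
  by move=> wz /df; exact: cdiff_diff_quotient.
(* The only possible singularity [z] lies on the circle of radius [cabs z], so the range of radii is
   cut there. *)
have G1 : circint G 0 = circint G (cabs z).
  have [->|z0] := eqVneq z 0; first by rewrite cabs0.
  apply: circint_eq => //; first by rewrite cabs_gt0.
  move=> w /andP[w0 wz]; apply: dG; last exact: lt_trans zr.
  by apply: contraTneq wz => ->; rewrite ltxx.
have G2 : circint G (cabs z) = circint G r.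
  apply: circint_eq => //; first exact: cabs_ge0.
  move=> w /andP[wz wr]; apply: dG => //.
  by apply: contraTneq wz => ->; rewrite ltxx.
move: G0; rewrite G1 G2 -(kernel_mean zr) => G0.
have ck := continuous_kernel zr.
have c1 : continuous (fun t => f z * (1 - z / circ r t)^-1).
  by apply: continuous_mulc; [move=> t; exact: cvg_cst|exact: ck].
have cfc : continuous (fun t => f (circ r t)).
  by move=> t; apply: (@continuous_comp _ _ _ (circ r) f); [exact: continuous_circ|exact: cf].
have c2 : continuous (fun t => f (circ r t) * (1 - z / circ r t)^-1).
  by apply: continuous_mulc; [exact: cfc|exact: ck].
rewrite -(cintZ _ _ _ ck); apply/eqP; rewrite -subr_eq0 -(cintB _ _ c2 c1).
apply/eqP; rewrite -[RHS]G0; apply: eq_cint => t _; rewrite -/(circ r t) -mulrBl /G /diff_quotient.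
have cz : circ r t != z.
  by apply: contraTneq zr => <-; rewrite cabs_circ ?ltxx// ltW.
have c0 := circ_neq0 t r0; have k0 := kernel_neq0 t zr.
rewrite (negbTE cz) mulrCA; congr (_ * _).
have -> : 1 - z / circ r t = (circ r t - z) / circ r t by rewrite mulrBl mulfV.
by rewrite invfM invrK mulrC.
Qed.

(** Cauchy's integral for the Taylor coefficient at 0: the power is [-k] rather than [-k - 1]
    because [d zeta = i zeta dt]. *)
Definition coef f r k : CC R :=
  (tau%:C)^-1 * cint 0 tau (fun t => f (circ r t) * (circ r t)^-1 ^+ k).

Let tauC0 : (tau%:C : CC R) != 0.
Proof. by rewrite -cabs_gt0 cabs_real normr_gt0 lt0r_neq0. Qed.

Lemma coef_le f r M k : continuous f -> 0 < r ->
  (forall w, cabs w = r -> cabs (f w) <= M) -> cabs (coef f r k) * r ^+ k <= 2 * M.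
Proof.
move=> cf r0 fM; rewrite /coef cabsM cabsV cabs_real gtr0_norm//.
have cfc : continuous (fun t => f (circ r t)).
  by move=> t; apply: (@continuous_comp _ _ _ (circ r) f); [exact: continuous_circ|exact: cf].
rewrite -mulrA mulrC ler_pdivrMr// -ler_pdivlMr ?exprn_gt0//.
have -> : 2 * M * tau / r ^+ k = 2 * (M / r ^+ k) * (tau - 0) by rewrite subr0; ring.
have c2 : continuous (fun t => f (circ r t) * (circ r t)^-1 ^+ k).
  by apply: continuous_mulc; [exact: cfc|apply: continuous_expc; exact: continuous_circV].
apply: (cint_le c2 (ltW tau_gt0)) => t _; rewrite cabsM cabsX cabsV cabs_circ ?(ltW r0)// exprVn.
by rewrite ler_wpM2r ?invr_ge0 ?exprn_ge0 ?(ltW r0)// fM// cabs_circ// ltW.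
Qed.

(** Explicit truncation errors instead of a limit: they are later integrated in the other variable,
    where the dependence on [n] must be kept. *)
Definition has_series f (a : nat -> CC R) r K :=
  forall z, cabs z < r -> forall n,
    cabs (f z - \sum_(k < n) a k * z ^+ k) <= K * ((cabs z / r) ^+ n / (1 - cabs z / r)).

Lemma holomorphic_series f r M : continuous f -> 0 < r ->
  (forall w, cabs w < r -> exists d, cdiff f w d) ->
  (forall w, cabs w = r -> cabs (f w) <= M) -> has_series f (coef f r) r (2 * M).
Proof.
move=> cf r0 df fM z zr n.
have cfc : continuous (fun t => f (circ r t)).
  by move=> t; apply: (@continuous_comp _ _ _ (circ r) f); [exact: continuous_circ|exact: cf].
have := @kernel_series (fun t => f (circ r t)) z r M n cfc zr.
have fM' t : cabs (f (circ r t)) <= M by apply: fM; rewrite cabs_circ// ltW.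
rewrite cauchy_formula// => /(_ fM') H.
have -> : f z - \sum_(k < n) coef f r k * z ^+ k = (tau%:C)^-1 * (f z * tau%:C -
    \sum_(k < n) z ^+ k * cint 0 tau (fun t => f (circ r t) * (circ r t)^-1 ^+ k)).
  rewrite mulrBr mulrCA mulVf// mulr1; congr (_ - _); rewrite mulr_sumr.
  by apply: eq_bigr => k _; rewrite /coef; ring.
by rewrite cabsM cabsV cabs_real gtr0_norm// mulrC ler_pdivrMr//; lra.
Qed.

End CauchySeries.

(** * Termwise differentiation of power series *)

Section PowerSeries.
Variable R : realType.
Implicit Types (f g : CC R -> CC R) (a : nat -> CC R) (c z w : CC R) (r s K : R).

Lemma cvg_dist_le (u : nat -> CC R) (l x : CC R) (C : R) : u @ \oo --> l ->
  (\forall n \near \oo, cabs (u n - x) <= C) -> cabs (l - x) <= C.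
Proof.
move=> /cvg_cabsP ul uC; apply/ler_addgt0Pl => e e0.
have [n [/= h1 h2]] := @filter_ex _ \oo _ _ (filterI (ul _ e0) uC).
have -> : l - x = (u n - x) - (u n - l) by ring.
by rewrite (le_trans (cabsB _ _))// addrC lerD// ltW.
Qed.

Lemma geometric_sum_le (q : R) n : 0 <= q < 1 -> \sum_(k < n) q ^+ k <= (1 - q)^-1.
Proof.
move=> /andP[q0 q1]; have p0 : 0 < 1 - q by rewrite subr_gt0.
rewrite -[leRHS]mul1r ler_pdivlMr//.
have -> : (\sum_(k < n) q ^+ k) * (1 - q) = 1 - q ^+ n.
  by rewrite -[RHS]opprB subrX1; ring.
by rewrite gerBl exprn_ge0.
Qed.

(** Bernoulli's inequality gives [k x <= (1 + x)^k], hence [k^2 q^k <= x^-2 (q (1 + x)^2)^k]; [x] is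
    taken small enough to keep the new ratio below 1. *)
Lemma square_geometric_bound (q : R) : 0 <= q < 1 -> exists C q' : R,
  [/\ 0 <= C, 0 <= q' < 1 & forall k : nat, k%:R ^+ 2 * q ^+ k <= C * q' ^+ k].
Proof.
move=> /andP[q0 q1]; have [x [x0 Hx]] : exists x : R, 0 < x /\ q * (1 + x) ^+ 2 < 1.
  by exists ((1 - q) / 4); split; [rewrite divr_gt0// subr_gt0|rewrite expr2; nra].
exists (x ^- 2), (q * (1 + x) ^+ 2); split.
- by rewrite invr_ge0 exprn_ge0// ltW.
- by rewrite Hx andbT mulr_ge0// sqr_ge0.
- move=> k; rewrite exprMn [X in _ * (_ * X)]exprAC.
  have h1 : 1 + k%:R * x <= (1 + x) ^+ k.
    elim: k => [|k IH]; first by rewrite mul0r addr0 expr0.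
    rewrite exprS -[k.+1%:R]natr1.
    have k0 : (0 : R) <= k%:R by [].
    have : (1 + x) * (1 + k%:R * x) <= (1 + x) * (1 + x) ^+ k by rewrite ler_wpM2l//; lra.
    nra.
  have kx0 : 0 <= k%:R * x by rewrite mulr_ge0// ltW.
  have h2 : (k%:R * x) ^+ 2 <= ((1 + x) ^+ k) ^+ 2.
    by rewrite lerXn2r ?nnegrE//; lra.
  rewrite mulrC [leRHS]mulrCA ler_wpM2l ?exprn_ge0// mulrC.
  by rewrite ler_pdivlMr ?exprn_gt0// -exprMn.
Qed.

Lemma geometric_series_cvg (u : nat -> CC R) (C q : R) : 0 <= q < 1 ->
  (forall k, cabs (u k) <= C * q ^+ k) -> exists l : CC R, (fun n => \sum_(k < n) u k : CC R) @ \oo --> l.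
Proof.
move=> /andP[q0 q1] uC.
have cgeo : cvgn (series (geometric C q)).
  by apply: is_cvg_geometric_series; rewrite ger0_norm.
have real_cvg (v : nat -> R) : (forall k, `|v k| <= C * q ^+ k) -> cvgn (series v).
  move=> vC; apply: normed_cvg; apply: (series_le_cvg _ _ _ cgeo) => k.
  - exact: normr_ge0.
  - exact: le_trans (normr_ge0 _) (vC k).
  - exact: vC.
have /cvg_ex[x xP] : cvgn (series (fun k => complex.Re (u k))).
  by apply: real_cvg => k; exact: le_trans (Re_le_cabs _) (uC k).
have /cvg_ex[y yP] : cvgn (series (fun k => complex.Im (u k))).
  by apply: real_cvg => k; exact: le_trans (Im_le_cabs _) (uC k).
exists (x +i* y : CC R).
have E n : \sum_(k < n) u k = series (fun k => complex.Re (u k)) n +i* series (fun k => complex.Im (u k)) n.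
  rewrite /series /= !big_mkord; elim: n => [|n IH]; first by rewrite !big_ord0.
  by rewrite !big_ord_recr /= IH; case: (u n).
under eq_fun do rewrite E.
exact: cvg_complex.
Qed.

(** The coefficient bound accompanies the convergence because it dominates the series geometrically
    on smaller discs, which is what termwise differentiation needs. *)
Definition power_series f a c r := (exists K, forall k, cabs (a k) * r ^+ k <= K) /\
  forall z, cabs (z - c) < r -> (fun n => \sum_(k < n) a k * (z - c) ^+ k) @ \oo --> f z.

(* Multiplied by s ^+ 2 to avoid the exponent k - 2. *)
Lemma power_taylor2 z w s k : 0 <= s -> cabs z <= s -> cabs w <= s ->
  s ^+ 2 * cabs (w ^+ k - z ^+ k - k%:R * z ^+ k.-1 * (w - z)) <= k%:R ^+ 2 * s ^+ k * cabs (w - z) ^+ 2.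
Proof.
move=> s0 zs ws; elim: k => [|k IH].
  by rewrite !expr0 subrr !mul0r subrr cabs0 mulr0 expr0n /= !mul0r.
(* The remainder of order [k.+1] is [w] times the previous one plus [k z^(k-1) (w - z)^2], and the
   bound closes because [k^2 + k <= (k + 1)^2]. *)
have -> : w ^+ k.+1 - z ^+ k.+1 - k.+1%:R * z ^+ k.+1.-1 * (w - z) =
   w * (w ^+ k - z ^+ k - k%:R * z ^+ k.-1 * (w - z)) + k%:R * z ^+ k.-1 * (w - z) ^+ 2.
  case: k {IH} => [|k] /=; first by rewrite !expr0 !expr1; ring.
  by rewrite !exprS -[k.+2%:R]natr1; ring.
set A := w ^+ k - z ^+ k - k%:R * z ^+ k.-1 * (w - z) in IH *.
set D := cabs (w - z) in IH *.
have D0 : 0 <= D by exact: cabs_ge0.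
have h1 : s ^+ 2 * cabs (w * A) <= k%:R ^+ 2 * s ^+ k.+1 * D ^+ 2.
  rewrite cabsM mulrCA [s ^+ k.+1]exprS.
  apply: (@le_trans _ _ (s * (k%:R ^+ 2 * s ^+ k * D ^+ 2))); last first.
    by rewrite le_eqVlt; apply/orP; left; apply/eqP; ring.
  by apply: ler_pM; rewrite ?cabs_ge0 ?mulr_ge0 ?exprn_ge0 ?cabs_ge0.
have h2 : s ^+ 2 * cabs (k%:R * z ^+ k.-1 * (w - z) ^+ 2) <= k%:R * s ^+ k.+1 * D ^+ 2.
  rewrite !cabsM cabs_nat !cabsX -/D.
  case: k {IH A h1} => [|k] /=; first by rewrite !mul0r mulr0.
  have : cabs z ^+ k <= s ^+ k by rewrite lerXn2r ?nnegrE ?cabs_ge0.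
  move=> h; have -> : s ^+ 2 * (k.+1%:R * cabs z ^+ k * D ^+ 2) = (k.+1%:R * s ^+ 2 * D ^+ 2) * cabs z ^+ k by ring.
  have -> : k.+1%:R * s ^+ k.+2 * D ^+ 2 = (k.+1%:R * s ^+ 2 * D ^+ 2) * s ^+ k by rewrite !exprS; ring.
  by rewrite ler_wpM2l// !mulr_ge0 ?exprn_ge0.
have h3 : s ^+ 2 * cabs (w * A + k%:R * z ^+ k.-1 * (w - z) ^+ 2) <=
    s ^+ 2 * cabs (w * A) + s ^+ 2 * cabs (k%:R * z ^+ k.-1 * (w - z) ^+ 2).
  by rewrite -mulrDr ler_wpM2l ?sqr_ge0// cabsD.
have sD : 0 <= s ^+ k.+1 * D ^+ 2 by rewrite mulr_ge0 ?exprn_ge0.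
have k0 : (0 : R) <= k%:R by [].
rewrite -[k.+1%:R]natr1.
apply: (le_trans h3); apply: (le_trans (lerD h1 h2)).
move: sD; rewrite -!mulrA; set X := s ^+ k.+1 * D ^+ 2 => sD; nra.
Qed.

(** Summing the second-order remainders of the powers bounds [f w - f z - g z * (w - z)] by
    [B * cabs (w - z) ^+ 2]; the sum is finite since [k^2 |a_k| s^k] decays geometrically for
    [s < r]. *)
Lemma power_series_derive f a c r s : power_series f a c r -> 0 < s -> s < r ->
  exists2 g, power_series g (fun k => k.+1%:R * a k.+1) c s &
    forall z, cabs (z - c) < s -> cdiff f z (g z).
Proof.
move=> [[K aK] fa] s0 sr; have r0 : 0 < r by exact: lt_trans sr.
have K0 : 0 <= K by apply: le_trans (aK 0%N); rewrite mulr_ge0 ?cabs_ge0// exprn_ge0// ltW.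
have q01 : 0 <= s / r < 1 by rewrite divr_ge0 ?(ltW r0) ?(ltW s0)//= ltr_pdivrMr// mul1r.
have [C [q' [C0 q'01 HC]]] := square_geometric_bound q01.
have [q'0 q'1] : 0 <= q' /\ q' < 1 by apply/andP.
have ak k : cabs (a k) * s ^+ k <= K * (s / r) ^+ k.
  rewrite exprMn exprVn mulrCA -[leLHS]mulrC ler_wpM2l ?exprn_ge0 ?(ltW s0)//.
  by rewrite ler_pdivlMr ?exprn_gt0.
have ak2 k : k%:R ^+ 2 * (cabs (a k) * s ^+ k) <= K * C * q' ^+ k.
  apply: (@le_trans _ _ (k%:R ^+ 2 * (K * (s / r) ^+ k))).
    by rewrite ler_wpM2l ?sqr_ge0.
  by have := HC k; move: (k%:R ^+ 2) (_ ^+ k) (q' ^+ k) => x y t; nra.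
have bK k : cabs (k.+1%:R * a k.+1) * s ^+ k <= K * C / s.
  rewrite ler_pdivlMr// cabsM cabs_nat.
  apply: (@le_trans _ _ (k.+1%:R ^+ 2 * (cabs (a k.+1) * s ^+ k.+1))).
    have -> : k.+1%:R * cabs (a k.+1) * s ^+ k * s = k.+1%:R * (cabs (a k.+1) * s ^+ k.+1) by rewrite exprS; ring.
    rewrite ler_wpM2r ?mulr_ge0 ?cabs_ge0 ?exprn_ge0 ?(ltW s0)//.
    by rewrite expr2 ler_peMr// ler1n.
  apply: (le_trans (ak2 _)); rewrite -[leRHS]mulr1 ler_wpM2l ?mulr_ge0//.
  by rewrite exprn_ile1// ltW.
(* Outside the disc the value is an arbitrary 0, so that [choice] yields a total function [g]. *)
have lim_ex z : exists l : CC R, cabs (z - c) < s ->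
    (fun n => \sum_(k < n) (k.+1%:R * a k.+1) * (z - c) ^+ k) @ \oo --> l.
  have [zs|] := boolP (cabs (z - c) < s); last by exists 0.
  have qz : 0 <= cabs (z - c) / s < 1 by rewrite divr_ge0 ?cabs_ge0 ?(ltW s0)//= ltr_pdivrMr// mul1r.
  have [|l hl] := @geometric_series_cvg (fun k => (k.+1%:R * a k.+1) * (z - c) ^+ k) (K * C / s) _ qz; last by exists l.
  move=> k; rewrite cabsM cabsX exprMn exprVn.
  have := bK k; rewrite -ler_pdivlMr ?exprn_gt0// => h.
  have -> : K * C / s * (cabs (z - c) ^+ k / s ^+ k) = K * C / s / s ^+ k * cabs (z - c) ^+ k by ring.
  by rewrite ler_wpM2r ?exprn_ge0 ?cabs_ge0.
have [g gP] := choice lim_ex.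
exists g; first by split; [exists (K * C / s)|].
move=> z zs e e0.
set B := K * C / (1 - q') / s ^+ 2.
have p0 : 0 < 1 - q' by rewrite subr_gt0.
have B0 : 0 <= B by rewrite /B divr_ge0 ?sqr_ge0// divr_ge0 ?(ltW p0)// mulr_ge0.
have key w : cabs (w - c) < s -> cabs (f w - f z - g z * (w - z)) <= B * cabs (w - z) ^+ 2.
  move=> ws; rewrite -[X in cabs X]subr0.
  pose S (x : CC R) n := \sum_(k < n) a k * (x - c) ^+ k.
  pose S' n := \sum_(k < n) (k.+1%:R * a k.+1) * (z - c) ^+ k.
  (* The sums for [f] run one index further, because the [k]-th term of the derived series comes
     from the coefficient of index [k.+1]. *)
  have lim : (fun n => S w n.+1 - S z n.+1 - S' n * (w - z)) @ \oo --> f w - f z - g z * (w - z).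
    have Sf x : cabs (x - c) < s -> (fun n => S x n.+1) @ \oo --> f x.
      by move=> xs; rewrite (cvg_shiftS (S x)); apply: fa; exact: lt_trans sr.
    exact: (cvgB (cvgB (Sf _ ws) (Sf _ zs)) (cvgM (gP _ zs) (cvg_cst (w - z)))).
  apply: (cvg_dist_le lim); apply: nearW => n; rewrite subr0.
  have -> : S w n.+1 - S z n.+1 - S' n * (w - z) = \sum_(k < n.+1) a k *
      ((w - c) ^+ k - (z - c) ^+ k - k%:R * (z - c) ^+ k.-1 * ((w - c) - (z - c))).
    have -> : S' n = \sum_(k < n.+1) k%:R * a k * (z - c) ^+ k.-1.
      by rewrite big_ord_recl !mul0r add0r.
    rewrite /S -sumrB mulr_suml -sumrB; apply: eq_bigr => k _; ring.
  apply: (le_trans (cabs_sum _ _ _)).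
  apply: (@le_trans _ _ (\sum_(k < n.+1) (K * C * q' ^+ k / s ^+ 2 * cabs (w - z) ^+ 2))).
    apply: ler_sum => k _; rewrite cabsM.
    have h := power_taylor2 k (ltW s0) (ltW zs) (ltW ws).
    have s20 : 0 < s ^+ 2 by rewrite exprn_gt0.
    have -> : K * C * q' ^+ k / s ^+ 2 * cabs (w - z) ^+ 2 = (K * C * q' ^+ k * cabs (w - z) ^+ 2) / s ^+ 2 by ring.
    move: h; set X := cabs ((w - c) ^+ k - _ - _) => h.
    have -> : cabs (a k) * X = cabs (a k) * (s ^+ 2 * X) / s ^+ 2 by rewrite mulrCA mulrAC mulrV ?mul1r// unitfE gt_eqF.
    rewrite ler_wpM2r ?invr_ge0 ?sqr_ge0//.
    apply: (le_trans (ler_wpM2l (cabs_ge0 _) h)).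
    have -> : w - c - (z - c) = w - z by ring.
    have -> : cabs (a k) * (k%:R ^+ 2 * s ^+ k * cabs (w - z) ^+ 2) =
      (k%:R ^+ 2 * (cabs (a k) * s ^+ k)) * cabs (w - z) ^+ 2 by ring.
    by rewrite ler_wpM2r ?sqr_ge0.
  rewrite -mulr_suml ler_wpM2r ?sqr_ge0// -mulr_suml /B ler_wpM2r ?invr_ge0 ?sqr_ge0//.
  by rewrite -mulr_sumr ler_wpM2l ?mulr_ge0// geometric_sum_le.
(* The first radius keeps [w] in the disc, the second makes [B * cabs (w - z)] at most [e]. *)
exists (Num.min (s - cabs (z - c)) (e / (B + 1))).
  by rewrite lt_min subr_gt0 zs divr_gt0//; lra.
move=> w; rewrite lt_min => /andP[w1 w2].
have ws : cabs (w - c) < s.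
  have -> : w - c = (w - z) + (z - c) by ring.
  by rewrite (le_lt_trans (cabsD _ _))//; lra.
apply: (le_trans (key w ws)); rewrite expr2 mulrA ler_wpM2r ?cabs_ge0//.
move: w2; rewrite ltr_pdivlMr; last by lra.
by have := cabs_ge0 (w - z); nra.
Qed.

Definition cderiv f : CC R -> CC R := fun z => 'D_(1 : CC R) f z.

Lemma cderiv_cdiff f z d : cdiff f z d -> cderiv f z = d.
Proof. by move=> /cdiff_is_derive[]. Qed.

Lemma power_series_iter f a c r s p : power_series f a c r -> 0 < s -> s < r ->
  power_series (iter p cderiv f) (fun k => (((k + p)`!)%:R / (k`!)%:R) * a (k + p)%N) c s.
Proof.
move=> fa; elim: p s => [|p IH] s s0 sr.
  have [[K aK] fz] := fa; split.
    exists K => k; rewrite addn0 mulfV ?mul1r; last by rewrite pnatr_eq0 -lt0n fact_gt0.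
    apply: le_trans (aK k); rewrite ler_wpM2l ?cabs_ge0//.
    by rewrite lerXn2r ?nnegrE ?ltW//; exact: lt_trans sr.
  move=> z zs; under eq_fun do under eq_bigr do rewrite addn0 mulfV ?mul1r ?pnatr_eq0 -?lt0n ?fact_gt0//.
  by apply: fz; exact: lt_trans sr.
(* Each differentiation loses some radius, so the induction hypothesis is taken at the midpoint of
   [s] and [r]. *)
have m1 : s < (s + r) / 2 by lra.
have m2 : (s + r) / 2 < r by lra.
have m0 : 0 < (s + r) / 2 by lra.
have [g [gK gP] gd] := power_series_derive (IH _ m0 m2) s0 m1.
have E k : k.+1%:R * (((k.+1 + p)`!)%:R / (k.+1`!)%:R * a (k.+1 + p)%N) =
    ((k + p.+1)`!)%:R / (k`!)%:R * a (k + p.+1)%N :> CC R.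
  rewrite addSnnS [k.+1`!]factS natrM invfM.
  have k0 : (k.+1%:R : CC R) != 0 by rewrite pnatr_eq0.
  move: (k.+1%:R) k0 ((k`!)%:R^-1) (((k + p.+1)`!)%:R) => x x0 y t.
  have -> : x * (t * (x^-1 * y) * a (k + p.+1)%N) = (x * x^-1) * (t * y * a (k + p.+1)%N) by ring.
  by rewrite mulfV// mul1r.
split.
  by have [K gK'] := gK; exists K => k; rewrite -E.
move=> z zs; rewrite iterS (cderiv_cdiff (gd z zs)).
by have := gP z zs; under eq_fun do under eq_bigr do rewrite E.
Qed.

(** At the centre every term of the [p]-fold differentiated series but the first vanishes, so its
    partial sums are constant from [n = 1] on. *)
Lemma power_series_coef f a c r p : power_series f a c r -> 0 < r ->
  iter p cderiv f c = (p`!)%:R * a p.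
Proof.
move=> fa r0; have r20 : 0 < r / 2 by rewrite divr_gt0.
have r2r : r / 2 < r by lra.
have [_ H] := power_series_iter p fa r20 r2r.
have := H c; rewrite subrr cabs0 => L.
have {}L : (fun n => \sum_(k < n) (((k + p)`!)%:R / (k`!)%:R) * a (k + p)%N * (0 : CC R) ^+ k) @ \oo --> iter p cderiv f c.
  exact: L.
apply/eqP; rewrite -subr_eq0 -cabs_eq0 eq_le cabs_ge0 andbT.
apply: (cvg_dist_le L); exists 1%N => // n /= n1; case: n n1 => // n _.
rewrite big_ord_recl big1 ?addr0; last first.
  by move=> i _; rewrite exprS mul0r mulr0.
by rewrite expr0 mulr1 add0n fact0 divr1 subrr cabs0.
Qed.

(** * Partial derivatives as iterated one-variable derivatives *)

Lemma dz1E (G : CC R * CC R -> CC R) z1 z2 : dz1 G (z1, z2) = cderiv (fun u => G (u, z2)) z1.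
Proof.
have E : (fun h : CC R => h^-1 *: ((G \o shift (z1, z2)) (h *: ((1 : CC R), (0 : CC R))) - G (z1, z2))) =
    (fun h : CC R => h^-1 *: (((fun u => G (u, z2)) \o shift z1) (h *: (1 : CC R)) - G (z1, z2))).
  apply: funext => h; congr (_ *: (G _ - _)).
  by apply/eqP; rewrite -pair_eqE /= /pair_eq /= ?scaler0 ?add0r !eqxx.
by rewrite /dz1 /cderiv /derive E.
Qed.

Lemma dz2E (G : CC R * CC R -> CC R) z1 z2 : dz2 G (z1, z2) = cderiv (fun v => G (z1, v)) z2.
Proof.
have E : (fun h : CC R => h^-1 *: ((G \o shift (z1, z2)) (h *: ((0 : CC R), (1 : CC R))) - G (z1, z2))) =
    (fun h : CC R => h^-1 *: (((fun v => G (z1, v)) \o shift z2) (h *: (1 : CC R)) - G (z1, z2))).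
  apply: funext => h; congr (_ *: (G _ - _)).
  by apply/eqP; rewrite -pair_eqE /= /pair_eq /= ?scaler0 ?add0r !eqxx.
by rewrite /dz2 /cderiv /derive E.
Qed.

Lemma pderivE (F : CC R * CC R -> CC R) p q z1 z2 :
  pderiv F p q (z1, z2) = iter p cderiv (fun u => iter q cderiv (fun v => F (u, v)) z2) z1.
Proof.
have E2 u v : iter q (@dz2 R) F (u, v) = iter q cderiv (fun v => F (u, v)) v.
  elim: q u v => [//|q IH] u v; rewrite !iterS dz2E; congr (cderiv _ _).
  by apply: funext => x; exact: IH.
rewrite /pderiv; elim: p z1 z2 => [|p IH] z1 z2; first exact: E2.
by rewrite !iterS dz1E; congr (cderiv _ _); apply: funext => x; exact: IH.
Qed.

End PowerSeries.

(** * Double power series on a bidisc *)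

Lemma continuous_cstT (T U : topologicalType) (x : U) : continuous (fun _ : T => x).
Proof. by move=> t; exact: cvg_cst. Qed.

Lemma continuous_idT (T : topologicalType) : continuous (fun t : T => t).
Proof. by move=> t; exact: cvg_id. Qed.

Section Bidisc.
Variable R : realType.
Implicit Types (z w : CC R * CC R) (u v : CC R).

(* A continuous retraction onto a closed disc: precomposing with it makes a
   function on a closed bidisc continuous on the whole space, as the integrands
   are required to be. *)
Definition clamp (r : R) (u : CC R) : CC R := ((r / Num.max r (cabs u))%:C : CC R) * u.

Lemma clamp_id (r : R) u : 0 < r -> cabs u <= r -> clamp r u = u.
Proof. by move=> r0 ur; rewrite /clamp max_l// divff ?gt_eqF// mul1r. Qed.

Lemma clamp_le (r : R) u : 0 < r -> cabs (clamp r u) <= r.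
Proof.
move=> r0; have m0 : 0 < Num.max r (cabs u) by rewrite lt_max r0.
rewrite cabsM cabs_real ger0_norm; last by rewrite divr_ge0 ?(ltW r0) ?(ltW m0).
by rewrite mulrAC ler_pdivrMr// ler_pM2l// le_max lexx orbT.
Qed.

Lemma continuous_clamp (r : R) : 0 < r -> continuous (clamp r).
Proof.
move=> r0.
have C1 : continuous (fun u : CC R => Num.max r (cabs u)).
  move=> u; apply: (@continuous_comp _ _ _ (@cabs R) (fun x => Num.max r x)); first exact: continuous_cabs.
  by apply: continuous_max; [exact: cvg_cst|exact: cvg_id].
have C2 : continuous (fun u : CC R => r / Num.max r (cabs u)).
  move=> u; have m0 : Num.max r (cabs u) != 0 by rewrite gt_eqF// lt_max r0.
  apply: (@continuous_comp _ _ _ (fun u : CC R => Num.max r (cabs u)) (fun x => r / x)); first exact: C1.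
  by apply: cvgM; [exact: cvg_cst|apply: cvgV => //; exact: cvg_id].
apply: continuous_mulc; last exact: continuous_idT.
move=> u; apply: (@cvg_complex R (CC R) (nbhs u) (nbhs_filter u) (fun u => r / Num.max r (cabs u)) (fun=> 0)).
  exact: C2.
exact: continuous_cstT.
Qed.

Lemma coefE_cint (f : CC R -> CC R) r k : coef f r k = ((pi *+ 2)%:C)^-1 *
  cint 0 (pi *+ 2) (fun t => f (circ r t) * (circ r t)^-1 ^+ k).
Proof. by []. Qed.

Lemma continuous_coef_integrand (f : CC R -> CC R) r k : continuous f -> 0 < r ->
  continuous (fun t => f (circ r t) * (circ r t)^-1 ^+ k).
Proof.
move=> cf r0; apply: continuous_mulc; last by apply: continuous_expc; exact: continuous_circV.
by move=> t; apply: (@continuous_comp _ _ _ (circ r) f); [exact: continuous_circ|exact: cf].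
Qed.

Lemma coef_combination (f : CC R -> CC R) (g : nat -> CC R -> CC R) (x : nat -> CC R) r k n :
  continuous f -> (forall i, continuous (g i)) -> 0 < r ->
  coef (fun v => f v - \sum_(i < n) g i v * x i) r k = coef f r k - \sum_(i < n) coef (g i) r k * x i.
Proof.
move=> cf cg r0; rewrite !coefE_cint.
have c1 := @continuous_coef_integrand f r k cf r0.
have c2 i := @continuous_coef_integrand (g i) r k (cg i) r0.
have c3 i : continuous (fun t => x i * (g i (circ r t) * (circ r t)^-1 ^+ k)).
  by apply: continuous_mulc; [exact: continuous_cstT|exact: c2].
rewrite (eq_cint (k := fun t => f (circ r t) * (circ r t)^-1 ^+ k -
   \sum_(i < n) x i * (g i (circ r t) * (circ r t)^-1 ^+ k))); last first.
  move=> t _; rewrite mulrBl mulr_suml; congr (_ - _).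
  by apply: eq_bigr => i _; ring.
rewrite (cintB _ _ c1 (@continuous_csum R n _ c3)) (cint_sum _ _ n c3) mulrBr mulr_sumr.
by congr (_ - _); apply: eq_bigr => i _; rewrite (cintZ _ _ _ (c2 i)) coefE_cint; ring.
Qed.

Section DoubleSeries.
Variables (G : CC R -> CC R -> CC R) (r1 r2 T : R).
Hypothesis r10 : 0 < r1.
Hypothesis r20 : 0 < r2.
Hypothesis cG : continuous (fun p : CC R * CC R => G p.1 p.2).
Hypothesis dG1 : forall v u, cabs u < r1 -> exists d, cdiff (fun u => G u v) u d.
Hypothesis dG2 : forall u v, cabs u < r1 -> cabs v < r2 -> exists d, cdiff (G u) v d.
Hypothesis GT : forall u v, cabs u = r1 -> cabs v = r2 -> cabs (G u v) <= T.

Lemma continuous_slice1 v : continuous (fun u => G u v).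
Proof.
move=> u; apply: (@continuous_comp _ _ _ (fun u => (u, v)) (fun p => G p.1 p.2)); last exact: cG.
by move: u; apply: continuous_pairT; [exact: continuous_idT|exact: continuous_cstT].
Qed.

Lemma continuous_slice2 u : continuous (G u).
Proof.
move=> v; apply: (@continuous_comp _ _ _ (fun v => (u, v)) (fun p => G p.1 p.2)); last exact: cG.
by move: v; apply: continuous_pairT; [exact: continuous_cstT|exact: continuous_idT].
Qed.

Definition slice_coef k v := coef (fun u => G u v) r1 k.
(** Rows are expanded in [v] for fixed [u]; the double coefficients turn out to be the Taylor
    coefficients of [row_coef q] in [u]. *)
Definition row_coef q u := coef (G u) r2 q.
Definition double_coef k q := coef (slice_coef k) r2 q.

Lemma continuous_slice_coef k : continuous (slice_coef k).
Proof.
rewrite /slice_coef; under eq_fun do rewrite coefE_cint.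
apply: continuous_mulc; first exact: continuous_cstT.
apply: (@continuous_cint R (CC R) 0 (pi *+ 2) (fun v t => G (circ r1 t) v * (circ r1 t)^-1 ^+ k)).
  by rewrite mulrn_wge0// pi_ge0.
have c1 : continuous (fun p : CC R * R => circ r1 p.2).
  by move=> p; apply: (@continuous_comp _ _ _ snd (circ r1)); [exact: cvg_snd|exact: continuous_circ].
apply: continuous_mulc; last first.
  apply: continuous_expc => p.
  apply: (@continuous_comp _ _ _ snd (fun t => (circ r1 t)^-1)); [exact: cvg_snd|exact: continuous_circV].
move=> p; apply: (@continuous_comp _ _ _ (fun p : CC R * R => (circ r1 p.2, p.1)) (fun p => G p.1 p.2)); last exact: cG.
by move: p; apply: continuous_pairT; [exact: c1|move=> p; exact: cvg_fst].
Qed.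

Lemma slice_coef_le k v : cabs v = r2 -> cabs (slice_coef k v) <= 2 * T / r1 ^+ k.
Proof.
move=> v2; rewrite ler_pdivlMr ?exprn_gt0//.
by apply: (@coef_le _ (fun u => G u v) r1 T k (@continuous_slice1 v) r10) => u u1; exact: GT.
Qed.

(** Cauchy's estimate applied once in each variable, with a factor 2 each time. *)
Lemma double_coef_le k q : cabs (double_coef k q) * r1 ^+ k * r2 ^+ q <= 4 * T.
Proof.
have := @coef_le _ _ r2 (2 * T / r1 ^+ k) q (@continuous_slice_coef k) r20 (@slice_coef_le k).
rewrite -/(double_coef k q) mulrA -ler_pdivlMr ?exprn_gt0//.
have e1 : 0 < r1 ^+ k by rewrite exprn_gt0.
rewrite ler_pdivlMr ?exprn_gt0// mulrA ler_pdivlMr//; lra.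
Qed.

Lemma slice_series u v n : cabs u < r1 -> cabs v = r2 ->
  cabs (G u v - \sum_(k < n) slice_coef k v * u ^+ k) <= 2 * T * ((cabs u / r1) ^+ n / (1 - cabs u / r1)).
Proof.
move=> u1 v2.
have b (w : CC R) : cabs w = r1 -> cabs (G w v) <= T by move=> w1; exact: GT.
exact: (@holomorphic_series _ (fun u => G u v) r1 T (@continuous_slice1 v) r10 (dG1 v) b u u1 n).
Qed.

(** The truncation estimate with [n = 0] replaces the maximum principle, with a constant that
    degenerates as [cabs u] approaches [r1]. *)
Lemma row_bound u v : cabs u < r1 -> cabs v = r2 -> cabs (G u v) <= 2 * T / (1 - cabs u / r1).
Proof.
move=> u1 v2; have := slice_series 0 u1 v2.
by rewrite big_ord0 subr0 expr0 mul1r.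
Qed.

Lemma row_series u v n : cabs u < r1 -> cabs v < r2 ->
  cabs (G u v - \sum_(q < n) row_coef q u * v ^+ q) <=
  2 * (2 * T / (1 - cabs u / r1)) * ((cabs v / r2) ^+ n / (1 - cabs v / r2)).
Proof.
move=> u1 v2.
have d (w : CC R) : cabs w < r2 -> exists d, cdiff (G u) w d by exact: dG2.
have b (w : CC R) : cabs w = r2 -> cabs (G u w) <= 2 * T / (1 - cabs u / r1) by exact: row_bound.
exact: (@holomorphic_series _ (G u) r2 _ (@continuous_slice2 u) r20 d b v v2 n).
Qed.

Lemma row_coef_le u q : cabs u < r1 -> cabs (row_coef q u) * r2 ^+ q <= 2 * (2 * T / (1 - cabs u / r1)).
Proof.
by move=> u1; apply: (@coef_le _ (G u) r2 _ q (@continuous_slice2 u) r20) => w w2; exact: row_bound.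
Qed.

(** Taking coefficients in [v] is linear, so the difference is the [q]-th coefficient of the
    remainder of the slice expansion, to which Cauchy's estimate on [cabs v = r2] applies. *)
Lemma row_coef_series u q n : cabs u < r1 ->
  cabs (row_coef q u - \sum_(k < n) double_coef k q * u ^+ k) * r2 ^+ q <=
  2 * (2 * T * ((cabs u / r1) ^+ n / (1 - cabs u / r1))).
Proof.
move=> u1; rewrite /row_coef /double_coef.
rewrite -(@coef_combination (G u) slice_coef (fun k => u ^+ k) r2 q n (@continuous_slice2 u) (@continuous_slice_coef) r20).
apply: coef_le; [|exact: r20|].
  have c1 k : continuous (fun v => slice_coef k v * u ^+ k).
    by apply: continuous_mulc; [exact: (@continuous_slice_coef k)|exact: continuous_cstT].
  have c2 : continuous (fun v => \sum_(k < n) slice_coef k v * u ^+ k).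
    elim: n => [|n IH].
      by under eq_fun do rewrite big_ord0; exact: continuous_cstT.
    under eq_fun do rewrite big_ord_recr /=.
    by move=> v; exact: (cvgD (IH v) (c1 n v)).
  by move=> v; exact: (cvgB (@continuous_slice2 u v) (c2 v)).
by move=> v v2; exact: slice_series.
Qed.

Lemma geometric_cvg0 (C q e : R) : 0 <= q < 1 -> 0 < e -> \forall n \near \oo, C * q ^+ n < e.
Proof.
move=> /andP[q0 q1] e0.
have : (fun n => C * q ^+ n) @ \oo --> C * 0.
  by apply: cvgM; [exact: cvg_cst|apply: cvg_expr; rewrite ger0_norm].
rewrite mulr0 => /cvgrPdist_lt/(_ _ e0); apply: filterS => n.
by rewrite sub0r normrN; apply: le_lt_trans; exact: ler_norm.
Qed.

Lemma row_power_series u : cabs u < r1 -> power_series (G u) (fun q => row_coef q u) 0 r2.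
Proof.
move=> u1; split; first by exists (2 * (2 * T / (1 - cabs u / r1))) => q; exact: row_coef_le.
move=> v; rewrite subr0 => v2; apply/cvg_cabsP => e e0.
apply: filterS (geometric_cvg0 (2 * (2 * T / (1 - cabs u / r1)) / (1 - cabs v / r2)) (ratio_bounds v2) e0) => n.
by apply: le_lt_trans; rewrite cabs_dist; apply: (le_trans (row_series n u1 v2)); rewrite mulrA mulrAC.
Qed.

Lemma double_power_series q : power_series (row_coef q) (fun k => double_coef k q) 0 r1.
Proof.
split.
  exists (4 * T / r2 ^+ q) => k; rewrite ler_pdivlMr ?exprn_gt0//; exact: double_coef_le.
move=> u; rewrite subr0 => u1; apply/cvg_cabsP => e e0.
apply: filterS (geometric_cvg0 (2 * (2 * T) / (1 - cabs u / r1) / r2 ^+ q) (ratio_bounds u1) e0) => n.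
apply: le_lt_trans; rewrite cabs_dist.
have := row_coef_series q n u1; rewrite -ler_pdivlMr ?exprn_gt0// => h.
by apply: (le_trans h); rewrite le_eqVlt; apply/orP; left; apply/eqP; ring.
Qed.

(** Truncating the row expansion in [v] and then each row coefficient in [u] costs at most
    [4 T q^n / (1 - q)^2] each time, which makes the 8. *)
Lemma double_series_bound u v (q : R) n : 0 <= q < 1 -> cabs u <= q * r1 -> cabs v <= q * r2 ->
  cabs (G u v) <= \sum_(j < n) \sum_(k < n) cabs (double_coef k j) * (q * r1) ^+ k * (q * r2) ^+ j
     + 8 * T / (1 - q) ^+ 2 * q ^+ n.
Proof.
move=> q01; have [q0 q1] : 0 <= q /\ q < 1 by apply/andP.
move=> uq vq; have p0 : 0 < 1 - q by rewrite subr_gt0.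
have u1 : cabs u < r1 by rewrite (le_lt_trans uq)// gtr_pMl.
have v2 : cabs v < r2 by rewrite (le_lt_trans vq)// gtr_pMl.
have T0 : 0 <= T.
  have h : cabs (r1%:C : CC R) = r1 by rewrite cabs_real gtr0_norm.
  have h' : cabs (r2%:C : CC R) = r2 by rewrite cabs_real gtr0_norm.
  exact: le_trans (cabs_ge0 _) (GT h h').
have ratio (x y : R) : 0 < y -> 0 <= x -> x <= q * y -> [/\ 0 <= x / y, x / y <= q & (1 - x / y)^-1 <= (1 - q)^-1].
  move=> y0 x0 xy; have h : x / y <= q by rewrite ler_pdivrMr.
  split=> //; first by rewrite divr_ge0// ltW.
  by rewrite lef_pV2 ?posrE//; lra.
have [a0 aq ai] := ratio _ _ r10 (cabs_ge0 u) uq.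
have [b0 bq bi] := ratio _ _ r20 (cabs_ge0 v) vq.
have ai0 : 0 <= (1 - cabs u / r1)^-1 by rewrite invr_ge0; lra.
have bi0 : 0 <= (1 - cabs v / r2)^-1 by rewrite invr_ge0; lra.
have row j : cabs (row_coef j u) * cabs v ^+ j <=
    \sum_(k < n) cabs (double_coef k j) * (q * r1) ^+ k * (q * r2) ^+ j
    + 4 * T / (1 - q) * q ^+ n * q ^+ j.
  have h := row_coef_series j n u1.
  have e2 : 0 < r2 ^+ j by rewrite exprn_gt0.
  set S := \sum_(k < n) double_coef k j * u ^+ k in h.
  have hS : cabs S <= \sum_(k < n) cabs (double_coef k j) * (q * r1) ^+ k.
    apply: (le_trans (cabs_sum _ _ _)); apply: ler_sum => k _.
    rewrite cabsM cabsX ler_wpM2l ?cabs_ge0//.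
    by rewrite lerXn2r ?nnegrE ?cabs_ge0 ?mulr_ge0 ?(ltW r10).
  have hv : cabs v ^+ j <= q ^+ j * r2 ^+ j.
    by rewrite -exprMn lerXn2r ?nnegrE ?cabs_ge0 ?mulr_ge0 ?(ltW r20).
  have h3 : cabs (row_coef j u) <= cabs (row_coef j u - S) + cabs S.
    by have := cabsD (row_coef j u - S) S; rewrite subrK.
  rewrite -mulr_suml exprMn.
  have vj0 : 0 <= cabs v ^+ j by rewrite exprn_ge0 ?cabs_ge0.
  apply: (le_trans (ler_wpM2r vj0 h3)); rewrite mulrDl addrC; apply: lerD.
    by apply: ler_pM; rewrite ?cabs_ge0.
  apply: (le_trans (ler_wpM2l (cabs_ge0 _) hv)); rewrite mulrCA mulrC ler_wpM2r ?exprn_ge0//.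
  apply: (le_trans h).
  have -> : 4 * T / (1 - q) * q ^+ n = 2 * (2 * T * (q ^+ n / (1 - q))) by ring.
  rewrite !ler_wpM2l ?mulr_ge0//; apply: ler_pM; rewrite ?exprn_ge0//.
  by rewrite lerXn2r ?nnegrE.
have h := row_series n u1 v2.
set S := \sum_(q < n) row_coef q u * v ^+ q in h.
have h3 : cabs (G u v) <= cabs S + cabs (G u v - S).
  by have := cabsD S (G u v - S); rewrite addrC subrK.
have hS : cabs S <= \sum_(j < n) (\sum_(k < n) cabs (double_coef k j) * (q * r1) ^+ k * (q * r2) ^+ j
    + 4 * T / (1 - q) * q ^+ n * q ^+ j).
  apply: (le_trans (cabs_sum _ _ _)); apply: ler_sum => j _.
  by rewrite cabsM cabsX; exact: row.
have hrem : 2 * (2 * T / (1 - cabs u / r1)) * ((cabs v / r2) ^+ n / (1 - cabs v / r2)) <=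
    4 * T / (1 - q) ^+ 2 * q ^+ n.
  have -> : 4 * T / (1 - q) ^+ 2 * q ^+ n = 2 * (2 * T / (1 - q)) * (q ^+ n / (1 - q)).
    by field; rewrite gt_eqF.
  apply: ler_pM; rewrite ?mulr_ge0 ?exprn_ge0//.
    by rewrite !ler_wpM2l ?mulr_ge0.
  by apply: ler_pM; rewrite ?exprn_ge0// lerXn2r ?nnegrE.
have hgeo : \sum_(j < n) 4 * T / (1 - q) * q ^+ n * q ^+ j <= 4 * T / (1 - q) ^+ 2 * q ^+ n.
  rewrite -mulr_sumr.
  have -> : 4 * T / (1 - q) ^+ 2 * q ^+ n = 4 * T / (1 - q) * q ^+ n * (1 - q)^-1.
    by field; rewrite gt_eqF.
  by rewrite ler_wpM2l ?geometric_sum_le// mulr_ge0 ?exprn_ge0// divr_ge0 ?mulr_ge0// ltW.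
apply: (le_trans h3); apply: (le_trans (lerD hS (le_trans h hrem))).
rewrite big_split /= -addrA lerD2l.
apply: (le_trans (lerD hgeo (lexx _))).
by rewrite le_eqVlt; apply/orP; left; apply/eqP; field; rewrite gt_eqF.
Qed.

End DoubleSeries.

End Bidisc.

(** * Taylor expansion and Cauchy's estimates for analytic functions on polydiscs *)

Section Connection.
Variable R : realType.
Implicit Types (z w c : CC R * CC R) (F : CC R * CC R -> CC R).

Lemma differentiable_slice1 F z : differentiable F z -> exists d, cdiff (fun u => F (u, z.2)) z.1 d.
Proof.
move=> dF; have := @diff_derivable _ _ _ F z ((1 : CC R), (0 : CC R)) dF.
rewrite /derivable => /cvg_ex[d Hd]; exists d; apply: is_derive_cdiff.
have E : (fun h : CC R => h^-1 *: ((F \o shift z) (h *: ((1 : CC R), (0 : CC R))) - F z)) =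
    (fun h : CC R => h^-1 *: (((fun u => F (u, z.2)) \o shift z.1) (h *: (1 : CC R)) - F (z.1, z.2))).
  apply: funext => h; rewrite -surjective_pairing; congr (_ *: (F _ - _)).
  by apply/eqP; rewrite -pair_eqE /= /pair_eq /= ?scaler0 ?add0r !eqxx.
rewrite E in Hd; split; first by apply/cvg_ex; exists d.
by apply/cvg_lim => //; exact: norm_hausdorff.
Qed.

Lemma differentiable_slice2 F z : differentiable F z -> exists d, cdiff (fun v => F (z.1, v)) z.2 d.
Proof.
move=> dF; have := @diff_derivable _ _ _ F z ((0 : CC R), (1 : CC R)) dF.
rewrite /derivable => /cvg_ex[d Hd]; exists d; apply: is_derive_cdiff.
have E : (fun h : CC R => h^-1 *: ((F \o shift z) (h *: ((0 : CC R), (1 : CC R))) - F z)) =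
    (fun h : CC R => h^-1 *: (((fun v => F (z.1, v)) \o shift z.2) (h *: (1 : CC R)) - F (z.1, z.2))).
  apply: funext => h; rewrite -surjective_pairing; congr (_ *: (F _ - _)).
  by apply/eqP; rewrite -pair_eqE /= /pair_eq /= ?scaler0 ?add0r !eqxx.
rewrite E in Hd; split; first by apply/cvg_ex; exists d.
by apply/cvg_lim => //; exact: norm_hausdorff.
Qed.

Lemma cdiff_shift_eq (f g : CC R -> CC R) (a u d : CC R) (r : R) : cabs u < r ->
  (forall v, cabs v <= r -> g v = f (a + v)) -> cdiff f (a + u) d -> cdiff g u d.
Proof.
move=> ur gf fd.
have r0 : 0 < r - cabs u by rewrite subr_gt0.
apply: (@cdiff_near_eq _ (fun v => f (a + v)) _ _ _ _ r0).
  move=> w wu; rewrite gf//; have := cabsD (w - u) u; rewrite subrK; lra.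
move=> e e0; have [s s0 H] := fd e e0; exists s => // w ws.
have E : a + w - (a + u) = w - u by ring.
by have := H (a + w); rewrite E; apply.
Qed.

Lemma addcK (a u : CC R) : a + u - a = u.
Proof. by rewrite addrC addKr. Qed.

Section Expansion.
Variables (F : CC R * CC R -> CC R) (c1 c2 : CC R) (r1 r2 T : R).
Hypothesis r10 : 0 < r1.
Hypothesis r20 : 0 < r2.
Hypothesis sub : forall z, polydisc (c1, c2) r1 r2 z -> D2 z.
Hypothesis aF : analytic_D2 F.

Definition clamped u v := F (c1 + clamp r1 u, c2 + clamp r2 v).

Lemma clamped_inside u v : D2 (c1 + clamp r1 u, c2 + clamp r2 v).
Proof. by apply: sub; rewrite /polydisc /= !addcK; split; exact: clamp_le. Qed.

Lemma continuous_clamped : continuous (fun p : CC R * CC R => clamped p.1 p.2).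
Proof.
move=> p; apply: (@continuous_comp _ _ _ (fun p : CC R * CC R => (c1 + clamp r1 p.1, c2 + clamp r2 p.2)) F); last first.
  by apply: differentiable_continuous; apply: aF; exact: clamped_inside.
move: p; apply: continuous_pairT.
  have C u : {for u, continuous (fun u => c1 + clamp r1 u)}.
    exact: (cvgD (cvg_cst c1) (@continuous_clamp R r1 r10 u)).
  by move=> p; apply: (@continuous_comp _ _ _ fst (fun u => c1 + clamp r1 u)); [exact: cvg_fst|exact: C].
have C u : {for u, continuous (fun u => c2 + clamp r2 u)}.
  exact: (cvgD (cvg_cst c2) (@continuous_clamp R r2 r20 u)).
by move=> p; apply: (@continuous_comp _ _ _ snd (fun u => c2 + clamp r2 u)); [exact: cvg_snd|exact: C].
Qed.

Lemma clamped_cdiff1 v u : cabs u < r1 -> exists d, cdiff (fun u => clamped u v) u d.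
Proof.
move=> u1; have [d Hd] := differentiable_slice1 (aF (clamped_inside u v)).
exists d; apply: (@cdiff_shift_eq (fun u => F (u, c2 + clamp r2 v)) _ c1 _ _ _ u1).
  by move=> w w1; rewrite /clamped clamp_id.
by move: Hd; rewrite /= (clamp_id r10 (ltW u1)).
Qed.

Lemma clamped_cdiff2 u v : cabs u < r1 -> cabs v < r2 -> exists d, cdiff (clamped u) v d.
Proof.
move=> u1 v2; have [d Hd] := differentiable_slice2 (aF (clamped_inside u v)).
exists d; apply: (@cdiff_shift_eq (fun v => F (c1 + clamp r1 u, v)) _ c2 _ _ _ v2).
  by move=> w w2; rewrite /clamped (clamp_id r20 w2).
by move: Hd; rewrite /= (clamp_id r20 (ltW v2)).
Qed.

(** An upper bound is required for the [sup] in [Mmax] to dominate the values. The torus is covered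
    by a product of four segments, on which the clamped function is continuous. *)
Lemma torus_bounded : has_ubound [set cabs (F z) | z in torus (c1, c2) r1 r2].
Proof.
pose K : set ((R * R) * (R * R)) := (`[- r1, r1] `*` `[- r1, r1]) `*` (`[- r2, r2] `*` `[- r2, r2]).
have cK : compact K by do 2!apply: compact_setX; exact: segment_compact.
pose h (p : (R * R) * (R * R)) : R := cabs (clamped (p.1.1 +i* p.1.2) (p.2.1 +i* p.2.2)).
have ch : continuous h.
  move=> p; apply: (@continuous_comp _ _ _ (fun p : (R * R) * (R * R) => clamped (p.1.1 +i* p.1.2) (p.2.1 +i* p.2.2)) (@cabs R)); last exact: continuous_cabs.
  apply: (@continuous_comp _ _ _ (fun p : (R * R) * (R * R) => ((p.1.1 +i* p.1.2 : CC R), (p.2.1 +i* p.2.2 : CC R))) (fun p => clamped p.1 p.2)); last exact: continuous_clamped.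
  move: p; apply: continuous_pairT => p; apply: cvg_complex.
  - by apply: (@continuous_comp _ _ _ fst fst); exact: cvg_fst.
  - by apply: (@continuous_comp _ _ _ fst snd); [exact: cvg_fst|exact: cvg_snd].
  - by apply: (@continuous_comp _ _ _ snd fst); [exact: cvg_snd|exact: cvg_fst].
  - by apply: (@continuous_comp _ _ _ snd snd); exact: cvg_snd.
have /compact_bounded[M [_ HM]] : compact (h @` K).
  by apply: continuous_compact => //; exact: continuous_subspaceT.
exists (M + 1) => _ [[z1 z2] /= [h1 h2] <-].
have box (z : CC R) (r : R) : cabs z = r -> (- r <= complex.Re z <= r) /\ (- r <= complex.Im z <= r).
  by move=> <-; rewrite -!ler_norml Re_le_cabs Im_le_cabs.
have [b1 b2] := box _ _ h1; have [b3 b4] := box _ _ h2.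
have := HM (M + 1) _ (h ((complex.Re (z1 - c1), complex.Im (z1 - c1)), (complex.Re (z2 - c2), complex.Im (z2 - c2)))).
rewrite /= ltrDl => /(_ ltr01) H.
have ReIm (z : CC R) : (complex.Re z +i* complex.Im z : CC R) = z by case: z.
have KP : K ((complex.Re (z1 - c1), complex.Im (z1 - c1)), (complex.Re (z2 - c2), complex.Im (z2 - c2))).
  by split; split; rewrite /= in_itv /=.
apply: le_trans (H (ex_intro2 _ _ _ KP erefl)).
rewrite ger0_norm ?cabs_ge0// /h [X in cabs (clamped X _)]ReIm [X in cabs (clamped _ X)]ReIm.
by rewrite /clamped (clamp_id r10) ?h1// (clamp_id r20) ?h2// !subrKC.
Qed.

Lemma clamped_torus : (forall z, torus (c1, c2) r1 r2 z -> cabs (F z) <= T) ->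
  forall u v, cabs u = r1 -> cabs v = r2 -> cabs (clamped u v) <= T.
Proof.
move=> FT u v u1 v2; apply: FT; rewrite /torus /= !addcK.
by rewrite (clamp_id r10) ?u1// (clamp_id r20) ?v2.
Qed.

Hypothesis FT : forall z, torus (c1, c2) r1 r2 z -> cabs (F z) <= T.

(** The row expansion identifies the inner derivatives in the second variable with [q! * row_coef],
    and the expansion of [row_coef q] then yields the outer ones. *)
Lemma pderiv_double_coef p q : pderiv F p q (c1, c2) = (p`!)%:R * ((q`!)%:R * double_coef clamped r1 r2 p q).
Proof.
have GT := clamped_torus FT.
rewrite pderivE; apply: (@power_series_coef _ _ (fun k => (q`!)%:R * double_coef clamped r1 r2 k q) c1 r1) => //.
have H u : cabs (u - c1) < r1 -> iter q (@cderiv R) (fun v => F (u, v)) c2 = (q`!)%:R * row_coef clamped r2 q (u - c1).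
  move=> u1; apply: (@power_series_coef _ _ (fun q => row_coef clamped r2 q (u - c1)) c2 r2) => //.
  have [h1 h2] := row_power_series r10 r20 continuous_clamped clamped_cdiff1 clamped_cdiff2 GT u1.
  split=> // v v2; have := h2 (v - c2); rewrite subr0 => /(_ v2).
  by rewrite /clamped (clamp_id r10 (ltW u1)) (clamp_id r20 (ltW v2)) !subrKC.
have [[K HK] h2] := double_power_series r10 r20 continuous_clamped clamped_cdiff1 GT q.
split.
  exists ((q`!)%:R * K) => k; rewrite cabsM cabs_nat -mulrA ler_wpM2l//.
move=> u u1; rewrite H//.
have := h2 (u - c1); rewrite subr0 => /(_ u1) L.
under eq_fun do under eq_bigr do rewrite -mulrA.
under eq_fun do rewrite -mulr_sumr.
exact: (cvgM (cvg_cst _) L).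
Qed.

Lemma normalized_pderiv p q : cabs (pderiv F p q (c1, c2)) / ((p`!)%:R * (q`!)%:R) =
  cabs (double_coef clamped r1 r2 p q).
Proof.
rewrite pderiv_double_coef !cabsM !cabs_nat.
have p0 : ((p`!)%:R : R) != 0 by rewrite pnatr_eq0 -lt0n fact_gt0.
have q0 : ((q`!)%:R : R) != 0 by rewrite pnatr_eq0 -lt0n fact_gt0.
by field; rewrite p0 q0.
Qed.

Lemma polydisc_cauchy p q : cabs (pderiv F p q (c1, c2)) / ((p`!)%:R * (q`!)%:R) * r1 ^+ p * r2 ^+ q <= 4 * T.
Proof.
have := double_coef_le r10 r20 continuous_clamped (clamped_torus FT) p q.
by rewrite normalized_pderiv.
Qed.

Lemma polydisc_bound z (q : R) n : 0 <= q < 1 -> polydisc (c1, c2) (q * r1) (q * r2) z ->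
  cabs (F z) <= \sum_(j < n) \sum_(k < n)
     cabs (pderiv F k j (c1, c2)) / ((k`!)%:R * (j`!)%:R) * (q * r1) ^+ k * (q * r2) ^+ j
     + 8 * T / (1 - q) ^+ 2 * q ^+ n.
Proof.
move=> q01 [/= z1 z2]; have [q0 q1] : 0 <= q /\ q < 1 by apply/andP.
have := double_series_bound r10 r20 continuous_clamped clamped_cdiff1 clamped_cdiff2 (clamped_torus FT) n q01 z1 z2.
have z1' : cabs (z.1 - c1) <= r1 by apply: (le_trans z1); rewrite ler_piMl ?(ltW r10)// ltW.
have z2' : cabs (z.2 - c2) <= r2 by apply: (le_trans z2); rewrite ler_piMl ?(ltW r20)// ltW.
rewrite /clamped (clamp_id r10 z1') (clamp_id r20 z2') !subrKC -surjective_pairing => h.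
apply: (le_trans h); rewrite lerD2r; apply: ler_sum => j _; apply: ler_sum => k _.
by rewrite normalized_pderiv.
Qed.

End Expansion.

End Connection.

(** * Functions of bounded index *)

Section Index.
Variables (R : realType) (beta : R) (l1 l2 : CC R * CC R -> R) (F : CC R * CC R -> CC R).
Hypothesis beta1 : 1 < beta.
Hypothesis adm : admissible_L beta l1 l2.
Hypothesis aF : analytic_D2 F.
Implicit Types z w : CC R * CC R.

Let I := index_term l1 l2 F.

Lemma l1_gt0 z : D2 z -> 0 < l1 z.
Proof.
move=> zD; have [_ _ h _] := adm zD; have [z1 _] := zD.
by apply: lt_trans h; rewrite divr_gt0 ?subr_gt0// (lt_trans ltr01 beta1).
Qed.

Lemma l2_gt0 z : D2 z -> 0 < l2 z.
Proof.
move=> zD; have [_ _ _ h] := adm zD; have [_ z2] := zD.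
by apply: lt_trans h; rewrite divr_gt0 ?subr_gt0// (lt_trans ltr01 beta1).
Qed.

(** Admissibility says precisely that [beta / l_j z < 1 - cabs z_j]. *)
Lemma polydisc_sub_D2 z (r1 r2 : R) : D2 z -> r1 <= beta -> r2 <= beta ->
  forall w, polydisc (z.1, z.2) (r1 / l1 z) (r2 / l2 z) w -> D2 w.
Proof.
move=> zD r1b r2b w [/= w1 w2]; have [_ _ h1 h2] := adm zD; have [z1 z2] := zD.
have L1 := l1_gt0 zD; have L2 := l2_gt0 zD.
have step (x y : CC R) (r l : R) : 0 < l -> cabs y < 1 -> beta / (1 - cabs y) < l -> r <= beta ->
    cabs (x - y) <= r / l -> cabs x < 1.
  move=> l0 y1 yl rb xy; move: yl; rewrite ltr_pdivrMr ?subr_gt0// mulrC -ltr_pdivrMr// => yl.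
  have : r / l <= beta / l by rewrite ler_wpM2r// invr_ge0 ltW.
  have := cabsD (x - y) y; rewrite subrK; lra.
by split; [exact: step L1 z1 h1 r1b w1|exact: step L2 z2 h2 r2b w2].
Qed.

Lemma index_term_ge0 z p q : D2 z -> 0 <= I z p q.
Proof.
move=> zD; rewrite divr_ge0 ?cabs_ge0// !mulr_ge0// exprn_ge0// ltW//.
  exact: l1_gt0.
exact: l2_gt0.
Qed.

Lemma index_termE z p q : D2 z ->
  I z p q = cabs (pderiv F p q (z.1, z.2)) / ((p`!)%:R * (q`!)%:R) / l1 z ^+ p / l2 z ^+ q.
Proof.
move=> zD; rewrite -surjective_pairing /I /index_term -!mulrA.
by rewrite !invfM !mulrA.
Qed.

(** The right-hand side of the inequality in [bounded_L_index]; the default 0 of the maxima is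
    harmless on the bidisc, where the terms are nonnegative. *)
Definition max_index (N : nat) z : R :=
  \big[Num.max/0]_(k1 < N.+1) \big[Num.max/0]_(k2 < N.+1 | (k1 + k2 <= N)%N) I z k1 k2.

Lemma max_index_ge0 N z : 0 <= max_index N z.
Proof. exact: bigmax_ge_id. Qed.

Lemma le_max_index N z p q : (p + q <= N)%N -> I z p q <= max_index N z.
Proof.
move=> pq; have p1 : (p < N.+1)%N by rewrite ltnS (leq_trans (leq_addr _ _) pq).
have q1 : (q < N.+1)%N by rewrite ltnS (leq_trans (leq_addl _ _) pq).
pose G (k1 : 'I_N.+1) := \big[Num.max/0]_(k2 < N.+1 | (k1 + k2 <= N)%N) I z k1 k2.
have h : I z p q <= G (Ordinal p1).
  rewrite /G.
  exact: (@le_bigmax_cond _ R 'I_N.+1 0 (Ordinal q1) (fun k2 : 'I_N.+1 => (p + k2 <= N)%N) (fun k2 : 'I_N.+1 => I z p k2) pq).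
apply: (le_trans h); rewrite /max_index.
exact: (@le_bigmax _ R 'I_N.+1 0 G (Ordinal p1)).
Qed.

Lemma max_index_le N z (X : R) : 0 <= X -> (forall p q, (p + q <= N)%N -> I z p q <= X) ->
  max_index N z <= X.
Proof.
move=> X0 H; apply: bigmax_le => // i _; apply: bigmax_le => // j ij; exact: H.
Qed.

Lemma torus_value_le z (r1 r2 : R) w : D2 z -> 0 < r1 -> 0 < r2 -> r1 <= beta -> r2 <= beta ->
  torus (z.1, z.2) (r1 / l1 z) (r2 / l2 z) w -> cabs (F w) <= Mmax F z (r1 / l1 z) (r2 / l2 z).
Proof.
move=> zD r10 r20 r1b r2b wT; rewrite [X in Mmax F X](surjective_pairing z).
have R1 : 0 < r1 / l1 z by rewrite divr_gt0// l1_gt0.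
have R2 : 0 < r2 / l2 z by rewrite divr_gt0// l2_gt0.
apply: ub_le_sup; last by exists w.
exact: (torus_bounded R1 R2 (polydisc_sub_D2 zD r1b r2b) aF).
Qed.

(** The condition [0 <= X] covers an empty torus, whose [sup] is 0. *)
Lemma Mmax_le z (r1 r2 X : R) : 0 <= X -> (forall w, torus z r1 r2 w -> cabs (F w) <= X) ->
  Mmax F z r1 r2 <= X.
Proof.
move=> X0 H; rewrite /Mmax.
have [->|/set0P ne] := eqVneq [set cabs (F w) | w in torus z r1 r2] set0; first by rewrite sup0.
by apply: ge_sup => // _ [w wT <-]; exact: H.
Qed.

Lemma Mmax_ge0 z (r1 r2 : R) : 0 <= Mmax F z r1 r2.
Proof.
rewrite /Mmax; set A := [set _ | _ in _].
have [hs|/sup_out ->//] := pselect (has_sup A).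
have [[x Ax] ub] := hs; apply: (le_trans _ (ub_le_sup ub Ax)).
by case: Ax => w _ <-; exact: cabs_ge0.
Qed.

Lemma index_cauchy z (r1 r2 T : R) p q : D2 z -> 0 < r1 -> 0 < r2 -> r1 <= beta -> r2 <= beta ->
  (forall w, torus (z.1, z.2) (r1 / l1 z) (r2 / l2 z) w -> cabs (F w) <= T) ->
  I z p q * r1 ^+ p * r2 ^+ q <= 4 * T.
Proof.
move=> zD r10 r20 r1b r2b H.
have L1 := l1_gt0 zD; have L2 := l2_gt0 zD.
have R1 : 0 < r1 / l1 z by rewrite divr_gt0.
have R2 : 0 < r2 / l2 z by rewrite divr_gt0.
have := polydisc_cauchy R1 R2 (polydisc_sub_D2 zD r1b r2b) aF H p q.
rewrite index_termE//; apply: le_trans; rewrite le_eqVlt; apply/orP; left; apply/eqP.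
by rewrite !exprMn !exprVn; ring.
Qed.

Lemma index_taylor z (r1 r2 T q : R) n w : D2 z -> 0 < r1 -> 0 < r2 -> r1 <= beta -> r2 <= beta ->
  (forall w, torus (z.1, z.2) (r1 / l1 z) (r2 / l2 z) w -> cabs (F w) <= T) ->
  0 <= q < 1 -> polydisc (z.1, z.2) (q * r1 / l1 z) (q * r2 / l2 z) w ->
  cabs (F w) <= \sum_(j < n) \sum_(k < n) I z k j * (q * r1) ^+ k * (q * r2) ^+ j
    + 8 * T / (1 - q) ^+ 2 * q ^+ n.
Proof.
move=> zD r10 r20 r1b r2b H q01; rewrite -!mulrA => wP.
have L1 := l1_gt0 zD; have L2 := l2_gt0 zD.
have R1 : 0 < r1 / l1 z by rewrite divr_gt0.
have R2 : 0 < r2 / l2 z by rewrite divr_gt0.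
have := polydisc_bound R1 R2 (polydisc_sub_D2 zD r1b r2b) aF H n q01 wP.
rewrite -!mulrA => h; apply: (le_trans h); rewrite lerD2r.
apply: ler_sum => j _; apply: ler_sum => k _; rewrite index_termE//.
rewrite le_eqVlt; apply/orP; left; apply/eqP.
by rewrite !exprMn !exprVn; ring.
Qed.

(** Taylor expansion on radii [1 / l_j z] with ratio 1/2: all coefficients are at most
    [max_index N z], and the double geometric sum contributes 2 in each variable. *)
Lemma max_index_bounds_halfdisc N z w :
  (forall p q, I z p q <= max_index N z) -> D2 z ->
  polydisc (z.1, z.2) (2^-1 / l1 z) (2^-1 / l2 z) w -> cabs (F w) <= 4 * max_index N z.
Proof.
move=> HN zD wP; set A := max_index N z.
have A0 : 0 <= A by exact: max_index_ge0.
have q01 : (0 : R) <= (2^-1 : R) < (1 : R).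
  by apply/andP; split; [rewrite invr_ge0|rewrite invf_lt1 ?ltr1n].
have b1 : 1 <= beta by exact: ltW.
pose T := Mmax F z (1 / l1 z) (1 / l2 z).
(* The torus maximum [T] enters only through the remainder, which vanishes as [n] grows. *)
rewrite -subr_le0; apply: (@le0_geometric _ _ (8 * T / (1 - 2^-1) ^+ 2) 2^-1) => // n.
rewrite lerBlDl.
have wP' : polydisc (z.1, z.2) (2^-1 * 1 / l1 z) (2^-1 * 1 / l2 z) w by rewrite mulr1.
apply: (le_trans (index_taylor n zD ltr01 ltr01 b1 b1 (fun w => @torus_value_le z 1 1 w zD ltr01 ltr01 b1 b1) q01 wP')).
rewrite lerD2r mulr1.
have gs : \sum_(k < n) 2^-1 ^+ k <= 2 :> R.
  apply: (le_trans (geometric_sum_le n q01)).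
  have -> : (1 - 2^-1 : R) = 2^-1 by lra.
  by rewrite invrK.
have S : forall j, \sum_(k < n) I z k j * 2^-1 ^+ k * 2^-1 ^+ j <= 2 * A * 2^-1 ^+ j.
  move=> j; rewrite -mulr_suml ler_wpM2r ?exprn_ge0 ?invr_ge0//.
  apply: (@le_trans _ _ (\sum_(k < n) A * 2^-1 ^+ k)).
    by apply: ler_sum => k _; rewrite ler_wpM2r ?exprn_ge0 ?invr_ge0.
  by rewrite -mulr_sumr mulrC ler_wpM2r.
apply: (@le_trans _ _ (\sum_(j < n) 2 * A * 2^-1 ^+ j)); first by apply: ler_sum => j _.
rewrite -mulr_sumr.
by move: gs; nra.
Qed.

(** The polydisc of radii [1 / (4 l_j z)] about [w] stays where [max_index_bounds_halfdisc] gives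
    [4 * max_index N z], and Cauchy's estimates contribute another 4. Its radii are at least
    [d / l_j w], and [d <= 1] bounds [d^(p+q)] below by [d^N]. *)
Lemma max_index_local N z w (d : R) :
  (forall z, D2 z -> forall p q, I z p q <= max_index N z) -> D2 z -> D2 w -> 0 < d -> d <= 1 ->
  polydisc (z.1, z.2) (4^-1 / l1 z) (4^-1 / l2 z) w ->
  4 * d <= l1 w / l1 z -> 4 * d <= l2 w / l2 z ->
  max_index N w <= 16 / d ^+ N * max_index N z.
Proof.
move=> HN zD wD d0 d1 wP dl1 dl2; set A := max_index N z.
have A0 : 0 <= A by exact: max_index_ge0.
have L1 := l1_gt0 zD; have L2 := l2_gt0 zD.
have K1 := l1_gt0 wD; have K2 := l2_gt0 wD.
have dN0 : 0 < d ^+ N by rewrite exprn_gt0.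
have b1 : 4^-1 <= beta by apply: le_trans (ltW beta1); lra.
have hd1 : d <= 4^-1 / l1 z * l1 w by move: dl1; rewrite mulrAC -mulrA; lra.
have hd2 : d <= 4^-1 / l2 z * l2 w by move: dl2; rewrite mulrAC -mulrA; lra.
have s1 : 0 < 4^-1 / l1 z by rewrite divr_gt0// invr_gt0.
have s2 : 0 < 4^-1 / l2 z by rewrite divr_gt0// invr_gt0.
have [/= w1 w2] := wP.
have Pw x : polydisc (w.1, w.2) (4^-1 / l1 z) (4^-1 / l2 z) x ->
    polydisc (z.1, z.2) (2^-1 / l1 z) (2^-1 / l2 z) x.
  move=> [/= x1 x2]; split => /=.
    have -> : x.1 - z.1 = (x.1 - w.1) + (w.1 - z.1) by rewrite addrA subrK.
    apply: (le_trans (cabsD _ _)); apply: (le_trans (lerD x1 w1)); lra.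
  have -> : x.2 - z.2 = (x.2 - w.2) + (w.2 - z.2) by rewrite addrA subrK.
  apply: (le_trans (cabsD _ _)); apply: (le_trans (lerD x2 w2)); lra.
have b2 : 2^-1 <= beta by apply: le_trans (ltW beta1); lra.
have subw x : polydisc (w.1, w.2) (4^-1 / l1 z) (4^-1 / l2 z) x -> D2 x.
  by move=> /Pw; exact: (polydisc_sub_D2 zD b2 b2).
have Tw x : torus (w.1, w.2) (4^-1 / l1 z) (4^-1 / l2 z) x -> cabs (F x) <= 4 * A.
  move=> [x1 x2]; apply: (@max_index_bounds_halfdisc N z) => //; first exact: HN.
  by apply: Pw; split; rewrite ?x1 ?x2.
apply: max_index_le; first by rewrite mulr_ge0// divr_ge0// ltW.
move=> p q pq.
have h := polydisc_cauchy s1 s2 subw aF Tw p q.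
have I0 : 0 <= I w p q by exact: index_term_ge0.
have h2 : I w p q * d ^+ N <= 16 * A.
  apply: (@le_trans _ _ (I w p q * (d ^+ p * d ^+ q))).
    by rewrite ler_wpM2l// -exprD; apply: ler_wiXn2l => //; exact: ltW.
  have -> : 16 * A = 4 * (4 * A) by ring.
  apply: le_trans h.
  have -> : cabs (pderiv F p q (w.1, w.2)) / (p`!%:R * q`!%:R) = I w p q * l1 w ^+ p * l2 w ^+ q.
    by rewrite index_termE// [RHS]mulrAC !divfK// expf_neq0// gt_eqF.
  have -> : I w p q * l1 w ^+ p * l2 w ^+ q * (4^-1 / l1 z) ^+ p * (4^-1 / l2 z) ^+ q =
      I w p q * ((4^-1 / l1 z * l1 w) ^+ p * (4^-1 / l2 z * l2 w) ^+ q).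
    by rewrite !exprMn; ring.
  rewrite ler_wpM2l//; apply: ler_pM; rewrite ?exprn_ge0 ?(ltW d0)//.
    by rewrite lerXn2r ?nnegrE ?(ltW d0)// (le_trans (ltW d0)).
  by rewrite lerXn2r ?nnegrE ?(ltW d0)// (le_trans (ltW d0)).
by rewrite mulrAC ler_pdivlMr.
Qed.

End Index.

(** * The two implications between bounded index and growth control *)

Section Characterization.
Variables (R : realType) (beta : R) (l1 l2 : CC R * CC R -> R) (F : CC R * CC R -> CC R).
Hypothesis beta1 : 1 < beta.
Hypothesis adm : admissible_L beta l1 l2.
Hypothesis Q2 : inQ2 beta l1 l2.
Hypothesis aF : analytic_D2 F.
Implicit Types z w : CC R * CC R.

Let beta0 : 0 < beta.
Proof. exact: lt_trans ltr01 beta1. Qed.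

Lemma bounded_index_of_growth (P : R) : 1 <= P ->
  (forall z, D2 z -> Mmax F z (beta / l1 z) (beta / l2 z) <= P * Mmax F z (1 / l1 z) (1 / l2 z)) ->
  bounded_L_index l1 l2 F.
Proof.
move=> P1 growth; pose q := beta^-1.
have q01 : (0 : R) <= (q : R) < (1 : R).
  by apply/andP; split; [rewrite invr_ge0 ltW|rewrite invf_lt1].
have [q0 q1] : 0 <= q /\ q < 1 by apply/andP.
have qb : q * beta = 1 by rewrite mulVf// gt_eqF.
have half0 : 0 < 2^-1 :> R by rewrite invr_gt0.
have [n hn] := filter_ex (geometric_cvg0 (P * (8 / (1 - q) ^+ 2)) q01 half0).
have [N [/= hN nN]] := filter_ex (filterI (geometric_cvg0 (8 * P * n%:R ^+ 2) q01 (ltr01 : 0 < 1 :> R)) (nbhs_infty_ge (n + n))).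
exists N => z zD k m; rewrite -/(max_index l1 l2 F N z).
set A := max_index l1 l2 F N z; have A0 : 0 <= A by exact: max_index_ge0.
have [kmN|kmN] := leqP (k + m) N; first exact: le_max_index.
pose T := Mmax F z (beta / l1 z) (beta / l2 z).
have T0 : 0 <= T by exact: Mmax_ge0.
have HT w : torus (z.1, z.2) (beta / l1 z) (beta / l2 z) w -> cabs (F w) <= T.
  by apply: (torus_value_le beta1 adm aF).
have In (i j : nat) : (i < n)%N -> (j < n)%N -> index_term l1 l2 F z i j <= A.
  by move=> ni nj; apply: le_max_index; rewrite (leq_trans _ nN)// leq_add// ltnW.
have M1 : Mmax F z (1 / l1 z) (1 / l2 z) <= n%:R ^+ 2 * A + 8 * T / (1 - q) ^+ 2 * q ^+ n.
  apply: Mmax_le.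
    rewrite addr_ge0//; first by rewrite mulr_ge0// exprn_ge0.
    by rewrite mulr_ge0 ?exprn_ge0// divr_ge0 ?sqr_ge0// mulr_ge0.
  move=> w [w1 w2].
  have wP : polydisc (z.1, z.2) (q * beta / l1 z) (q * beta / l2 z) w by rewrite qb; split; rewrite ?w1 ?w2.
  apply: (le_trans (index_taylor beta1 adm aF n zD beta0 beta0 (lexx _) (lexx _) HT q01 wP)).
  rewrite lerD2r qb.
  apply: (@le_trans _ _ (\sum_(j < n) \sum_(k < n) A)).
    by apply: ler_sum => j _; apply: ler_sum => i _; rewrite !expr1n !mulr1 In.
  by rewrite !sumr_const !card_ord -mulrnA -[A *+ _]mulr_natl natrM expr2.
have T2 : T <= 2 * P * (n%:R ^+ 2 * A).
  have h := le_trans (growth z zD) (ler_wpM2l (le_trans ler01 P1) M1).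
  have h2 : P * (8 * T / (1 - q) ^+ 2 * q ^+ n) <= 2^-1 * T.
    have -> : P * (8 * T / (1 - q) ^+ 2 * q ^+ n) = (P * (8 / (1 - q) ^+ 2) * q ^+ n) * T by ring.
    by rewrite ler_wpM2r// ltW.
  by move: h; rewrite -/T mulrDr; lra.
have hI := index_cauchy beta1 adm aF k m zD beta0 beta0 (lexx _) (lexx _) HT.
have hI2 : index_term l1 l2 F z k m <= 4 * T * q ^+ N.
  apply: (@le_trans _ _ (4 * T * q ^+ (k + m))).
    by rewrite exprVn ler_pdivlMr ?exprn_gt0// exprD mulrA.
  rewrite ler_wpM2l ?mulr_ge0//; apply: ler_wiXn2l => //; first exact: ltW.
  exact: ltnW.
apply: (le_trans hI2).
have h3 : 4 * T * q ^+ N <= 4 * (2 * P * (n%:R ^+ 2 * A)) * q ^+ N.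
  by rewrite ler_wpM2r ?exprn_ge0// ler_wpM2l.
apply: (le_trans h3).
have -> : 4 * (2 * P * (n%:R ^+ 2 * A)) * q ^+ N = (8 * P * n%:R ^+ 2 * q ^+ N) * A by ring.
by rewrite ler_piMl// ltW.
Qed.

Lemma max_index_polydisc N : (forall z, D2 z -> forall p q, index_term l1 l2 F z p q <= max_index l1 l2 F N z) ->
  exists2 C : R, 0 <= C & forall z w, D2 z -> polydisc z (beta / l1 z) (beta / l2 z) w ->
    max_index l1 l2 F N w <= C * max_index l1 l2 F N z.
Proof.
move=> HN.
have q40 : (0 : R) <= (4^-1 : R) <= (beta : R).
  apply/andP; split; first by rewrite invr_ge0.
  by apply: le_trans (ltW beta1); rewrite invf_le1// ler1n.
have bb : 0 <= beta <= beta by rewrite lexx ltW.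
have [[[d1 d10 H1] _] [[d2 d20 H2] _]] := Q2 q40 q40.
have [[_ [C1 HC1]] [_ [C2 HC2]]] := Q2 bb bb.
pose d := Num.min (1 : R) (Num.min (d1 / 4) (d2 / 4)).
have d0 : 0 < d by rewrite !lt_min ltr01 !divr_gt0.
have [dle1 dd1 dd2] : [/\ d <= 1, 4 * d <= d1 & 4 * d <= d2].
  have h : d <= d1 / 4 by rewrite /d !ge_min lexx !orbT.
  have h' : d <= d2 / 4 by rewrite /d !ge_min lexx !orbT.
  by split; [rewrite /d ge_min lexx|lra|lra].
pose K := 16 / d ^+ N.
have K0 : 0 <= K by rewrite divr_ge0// exprn_ge0// ltW.
have local z w : D2 z -> D2 w -> polydisc z (4^-1 / l1 z) (4^-1 / l2 z) w ->
    max_index l1 l2 F N w <= K * max_index l1 l2 F N z.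
  move=> zD wD wP; apply: (max_index_local beta1 adm aF HN zD wD d0 dle1).
  - by rewrite -surjective_pairing.
  - by apply: (le_trans dd1); exact: H1 wP.
  - by apply: (le_trans dd2); exact: H2 wP.
have [n hn] : exists n : nat, 4 * beta * (Num.max C1 C2) <= n.+1%:R.
  exists (Num.bound `|4 * beta * Num.max C1 C2|).
  apply/ltW; apply: (le_lt_trans (ler_norm _)); apply: (lt_le_trans (archi_boundP (normr_ge0 _))).
  by rewrite ler_nat.
exists (K ^+ n.+1); first exact: exprn_ge0.
move=> z w zD wP.
pose t (i : nat) : R := i%:R / n.+1%:R.
pose p i : CC R * CC R := (z.1 + (t i)%:C * (w.1 - z.1), z.2 + (t i)%:C * (w.2 - z.2)).
have [w1 w2] := wP.
have n0 : 0 < n.+1%:R :> R by rewrite ltr0n.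
have t01 i : (i <= n.+1)%N -> 0 <= t i <= 1.
  by move=> ni; rewrite divr_ge0//= ler_pdivrMr// mul1r ler_nat.
have L1 := l1_gt0 beta1 adm zD; have L2 := l2_gt0 beta1 adm zD.
have pP i : (i <= n.+1)%N -> polydisc z (beta / l1 z) (beta / l2 z) (p i).
  move=> /t01 /andP[t0 t1]; split; rewrite /= addcK cabsM cabs_real ger0_norm//.
    by apply: le_trans w1; rewrite ler_piMl// cabs_ge0.
  by apply: le_trans w2; rewrite ler_piMl// cabs_ge0.
have pD i : (i <= n.+1)%N -> D2 (p i).
  move=> /pP; rewrite {1}(surjective_pairing z).
  exact: (polydisc_sub_D2 beta1 adm zD (lexx _) (lexx _)).
have step i : (i <= n)%N -> polydisc (p i) (4^-1 / l1 (p i)) (4^-1 / l2 (p i)) (p i.+1).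
  move=> ni; have ni' : (i <= n.+1)%N by exact: leqW.
  have K1 := l1_gt0 beta1 adm (pD i ni'); have K2 := l2_gt0 beta1 adm (pD i ni').
  have E (x y : CC R) : x + (t i.+1)%:C * y - (x + (t i)%:C * y) = (n.+1%:R^-1)%:C * y.
    have -> : t i.+1 = t i + n.+1%:R^-1 by rewrite /t -[i.+1%:R]natr1 mulrDl mul1r.
    by rewrite rmorphD /=; ring.
  have small (x l l' Cj : R) : 0 < l -> 0 < l' -> 0 <= x -> x <= beta / l -> l' / l <= Cj -> Cj <= Num.max C1 C2 ->
      n.+1%:R^-1 * x <= 4^-1 / l'.
    move=> l0 l'0 x0 xl hC hM.
    rewrite mulrC ler_pdivrMr// mulrAC ler_pdivlMr//.
    have h1 : x * l' <= beta * Num.max C1 C2.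
      apply: (@le_trans _ _ (beta / l * l')); first by rewrite ler_wpM2r// ltW.
      rewrite mulrAC -mulrA ler_wpM2l ?(ltW beta0)//.
      exact: le_trans hC hM.
    by move: h1 hn; lra.
  split; rewrite /= E cabsM cabs_real ger0_norm ?invr_ge0//.
    apply: (small _ (l1 z) (l1 (p i)) C1) => //; first exact: cabs_ge0.
      exact: HC1 (pP i ni').
    by rewrite le_max lexx.
  apply: (small _ (l2 z) (l2 (p i)) C2) => //; first exact: cabs_ge0.
    exact: HC2 (pP i ni').
  by rewrite le_max lexx orbT.
have chain i : (i <= n.+1)%N -> max_index l1 l2 F N (p i) <= K ^+ i * max_index l1 l2 F N z.
  elim: i => [_|i IH ni].
    rewrite expr0 mul1r /p /t !mul0r !addr0 -surjective_pairing//.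
  apply: (le_trans (local _ _ (pD i (ltnW ni)) (pD i.+1 ni) (step i ni))).
  by rewrite exprS -mulrA ler_wpM2l// IH// ltnW.
have := chain n.+1 (leqnn _).
by rewrite /p /t divff ?gt_eqF// !mul1r !subrKC -surjective_pairing.
Qed.

Lemma growth_of_bounded_index (r1' r2' r1'' r2'' : R) : bounded_L_index l1 l2 F ->
  0 < r1' -> r1' < r1'' -> r1'' <= beta -> 0 < r2' -> r2' < r2'' -> r2'' <= beta ->
  exists2 P : R, 1 <= P & forall z, D2 z ->
    Mmax F z (r1'' / l1 z) (r2'' / l2 z) <= P * Mmax F z (r1' / l1 z) (r2' / l2 z).
Proof.
move=> [N HN] r10 r1lt r1b r20 r2lt r2b.
have r1b' : r1' <= beta by lra.
have r2b' : r2' <= beta by lra.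
have [C C0 HC] := max_index_polydisc HN.
pose s := Num.min (1 : R) (Num.min r1' r2').
have s0 : 0 < s by rewrite !lt_min ltr01 r10.
have [s1 sr1 sr2] : [/\ s <= 1, s <= r1' & s <= r2'] by rewrite /s !ge_min !lexx !orbT.
have sN : 0 < s ^+ N by rewrite exprn_gt0.
exists (Num.max 1 (C * (4 / s ^+ N))); first by rewrite le_max lexx.
move=> z zD; set T := Mmax F z (r1' / l1 z) (r2' / l2 z).
have T0 : 0 <= T by exact: Mmax_ge0.
have HT w : torus (z.1, z.2) (r1' / l1 z) (r2' / l2 z) w -> cabs (F w) <= T.
  by apply: (torus_value_le beta1 adm aF).
have L1 := l1_gt0 beta1 adm zD; have L2 := l2_gt0 beta1 adm zD.
have AT : max_index l1 l2 F N z <= 4 / s ^+ N * T.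
  apply: max_index_le; first by rewrite mulr_ge0// divr_ge0// ltW.
  move=> p q pq; rewrite mulrAC ler_pdivlMr//.
  have h := index_cauchy beta1 adm aF p q zD r10 r20 r1b' r2b' HT.
  have I0 := @index_term_ge0 R beta l1 l2 F beta1 adm z p q zD.
  apply: le_trans h; rewrite -mulrA ler_wpM2l//.
  apply: (@le_trans _ _ (s ^+ p * s ^+ q)).
    by rewrite -exprD; exact: (ler_wiXn2l (ltW s0) s1 pq).
  by apply: ler_pM; rewrite ?exprn_ge0 ?(ltW s0)// lerXn2r ?nnegrE// ltW.
apply: (@le_trans _ _ (C * (4 / s ^+ N) * T)); last by rewrite ler_wpM2r// le_max lexx orbT.
apply: Mmax_le; first by rewrite !mulr_ge0// invr_ge0 ltW.
move=> w [w1 w2].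
have wP : polydisc z (beta / l1 z) (beta / l2 z) w.
  by split; rewrite ?w1 ?w2 ler_wpM2r// invr_ge0 ltW.
have h0 : cabs (F w) = index_term l1 l2 F w 0 0.
  by rewrite /index_term /= !fact0 !expr0 !mulr1 invr1 mulr1.
rewrite h0; apply: (le_trans (@le_max_index R l1 l2 F N w 0 0 (leq0n N))).
by apply: (le_trans (HC z w zD wP)); rewrite -mulrA ler_wpM2l.
Qed.

End Characterization.

Theorem theorem5 (R : realType) (beta : R) (l1 l2 : CC R * CC R -> R)
    (F : CC R * CC R -> CC R) :
  1 < beta -> admissible_L beta l1 l2 -> inQ2 beta l1 l2 -> analytic_D2 F ->
  (bounded_L_index l1 l2 F <->
   forall r1' r2' r1'' r2'' : R,
     0 < r1' -> r1' < r1'' -> r1'' <= beta ->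
     0 < r2' -> r2' < r2'' -> r2'' <= beta ->
     exists2 p1 : R, 1 <= p1 &
       forall z0, D2 z0 ->
         Mmax F z0 (r1'' / l1 z0) (r2'' / l2 z0)
           <= p1 * Mmax F z0 (r1' / l1 z0) (r2' / l2 z0)).
Proof.
move=> beta1 adm Q2 aF; split=> [bI r1' r2' r1'' r2'' h1 h2 h3 h4 h5 h6|growth].
  exact: (growth_of_bounded_index beta1 adm Q2 aF bI).
have [P P1 HP] := growth 1 1 beta beta ltr01 beta1 (lexx _) ltr01 beta1 (lexx _).
exact: (bounded_index_of_growth beta1 adm aF P1 HP).
Qed.
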